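(* Let $(Y_t)_{t\ge 0}$ be the locally-balanced Markov jump process (LBMJP) with balancing function $g$, base kernel $\gamma$ and target distribution $\pi$, with jump rate $\lambda$ and embedded chain $X=(X_n)_{n\ge 0}$ with transition kernel $\Gamma_g$. Assume: (1) $\lambda(x)>0$ for all $x\in\mathrm{supp}(\pi)$; (2) $g$ is non-decreasing and continuous on $[0,\infty)$; (3) there is a non-trivial measure $\phi$ on $(E,\mathcal{E})$ such that for all $x\in\mathrm{supp}(\pi)$ and all $B\in\mathcal{E}$ with $\phi(B)>0$ there exists $n\in\mathbb{N}$ with $\mathbb{P}_x(X_n\in B)>0$; (4) for all $x\in\mathrm{supp}(\pi)$ and all $A\in\mathcal{E}$ with $\pi(A)=0$, $\Gamma_g(x,A)=0$. Then, from any starting state $x\in\mathrm{supp}(\pi)$: (a) The process $Y$ is almost surely non-explosive. (b) Almost surely, $Y_t\in\mathrm{supp}(\pi)$ and $\lambda(Y_t)<\infty$ for all $t\ge0$. (c) For all $f\in L^1(\pi)$, almost surely $$\lim_{t\to\infty}\frac1t\int_0^t f(Y_s)\,ds=\int_E f(x)\,\pi(dx).$$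
   Context: Let $E$ be a Polish space with Borel $\sigma$-algebra $\mathcal{E}$, $\pi$ a probability measure on $(E,\mathcal{E})$ with topological support $\mathrm{supp}(\pi)$, and $\gamma:E\times\mathcal{E}\to[0,1]$ a Markov kernel. Write $[\pi\otimes\gamma](dx,dy)=\pi(dx)\gamma(x,dy)$. The function $t:E\times E\to[0,\infty)$ is a version of the Radon--Nikodym derivative $t(x,y)=\frac{\pi(dy)\gamma(y,dx)}{\pi(dx)\gamma(x,dy)}$ such that, for some measurable $R\subset E\times E$ with $[\pi\otimes\gamma](R)=1$, one has $0<t(x,y)<\infty$ and $t(y,x)=1/t(x,y)$ for $(x,y)\in R$, and $t(x,y)=0$ for $(x,y)\notin R$. A balancing function is a (Borel) function $g:[0,\infty)\to[0,\infty)$ with $g(1)=1$, $g(0)=0$, $g(s)>0$ for $s>0$, and $g(s)=s\,g(1/s)$ for all $s>0$. Jump rate: $\lambda(x)=\int_E g(t(x,y))\,\gamma(x,dy)\in[0,\infty]$. Embedded kernel: $\Gamma_g(x,A)=\int_A \frac{g(t(x,y))}{\lambda(x)}\,\gamma(x,dy)$ (at degenerate points, where $\lambda(x)\in\{0,\infty\}$, set $\Gamma_g(x,\cdot)=\delta_x$). LBMJP started from $x\in\mathrm{supp}(\pi)$: let $X=(X_n)_{n\ge0}$ be the discrete-time Markov chain with $X_0=x$ and transition kernel $\Gamma_g$; given $X$, let $\tau_n\sim\mathrm{Exp}(\lambda(X_{n-1}))$, $n\ge1$, be conditionally independent ($\mathrm{Exp}(0)$ means $+\infty$, $\mathrm{Exp}(\infty)$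 means $0$); set $T_0=0$, $T_n=\sum_{k=1}^n\tau_k$. Then $Y_t=X_{\sup\{n:T_n\le t\}}$ if $t<\sup_n T_n$, and $Y_t=\partial$ (a graveyard state) otherwise. $\mathbb{P}_x$ denotes the law when started from $x$. The process is non-explosive if $\sum_{k\ge1}\tau_k=\infty$ almost surely. *)

(* Defs.v *)
From HB Require Import structures.
From mathcomp Require Import all_boot all_order all_algebra.
From mathcomp Require Import all_classical all_reals all_analysis.
From mathcomp Require Import measurable_realfun.

Set Implicit Arguments.
Unset Strict Implicit.
Unset Printing Implicit Defensive.

Import Order.TTheory GRing.Theory Num.Theory.
Import numFieldNormedType.Exports.

Local Open Scope classical_set_scope.
Local Open Scope ring_scope.
Local Open Scope ereal_scope.

(* Separable, and homeomorphic to a complete metric space [M]. *)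
Definition polish (R : realType) (T : topologicalType) : Prop :=
  (exists2 D : set T, countable D & dense D) /\
  exists (M : metricType R) (h : T -> M) (k : M -> T),
    [/\ cancel h k, cancel k h, continuous h, continuous k
      & forall F : set_system M, ProperFilter F -> cauchy F ->
          exists l : M, F --> l].

(* The carrier [E] equipped with its Borel sigma-algebra. *)
Notation borel E := (g_sigma_algebraType (@open E)).

Section target_and_base_kernel.
Context (R : realType) (E : ptopologicalType).
Variables (pi : probability (borel E) R)
  (gamma : R.-pker (borel E) ~> (borel E)).

Definition supp : set E :=
  [set x | forall U : set E, open U -> U x -> 0 < pi U].

(* pi(dx) gamma(x, dy) *)
Definition otimes (A : set (borel E * borel E)) : \bar R :=
  \int[pi]_x gamma x (xsection A x).

Let otimes0 : otimes set0 = 0.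
Proof. by apply: integral0_eq => x _; rewrite xsection0 measure0. Qed.

Let otimes_ge0 A : 0 <= otimes A.
Proof. exact: integral_ge0. Qed.

Let otimes_sigma_additive : semi_sigma_additive otimes.
Proof.
move=> F mF tF mUF.
have mFx n x : measurable (xsection (F n) x) by exact: measurable_xsection.
rewrite /otimes [X in _ --> X](_ : _ =
    \sum_(0 <= n <oo) \int[pi]_x gamma x (xsection (F n) x)).
  by apply: is_cvg_nneseries => n _ _; exact: integral_ge0.
rewrite -integral_nneseries//; last first.
  by move=> n; apply: measurable_fun_xsection_finite_kernel; rewrite inE.
apply: eq_integral => x _; rewrite xsection_bigcup measure_bigcup//.
  by apply: eq_eseriesl => n; rewrite in_setT.
exact: trivIset_xsection.
Qed.

HB.instance Definition _ := isMeasure.Build _ _ _ otimes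
  otimes0 otimes_ge0 otimes_sigma_additive.

(* [t] is a version of the derivative of pi(dy) gamma(y, dx) with respect to
   pi(dx) gamma(x, dy), positive and with t(y, x) = 1 / t(x, y) on a set [S] of
   full measure, and null off [S]. *)
Definition density_ratio (t : borel E * borel E -> R) : Prop :=
  [/\ measurable_fun setT t,
      forall z, (0 <= t z)%R,
      forall A, measurable A ->
        \int[otimes]_(z in A) (t z)%:E =
        pushforward otimes (fun z : borel E * borel E => (z.2, z.1)) A
    & exists S : set (borel E * borel E),
      [/\ measurable S, otimes S = 1,
          forall x y, S (x, y) -> (0 < t (x, y))%R /\ t (y, x) = (t (x, y))^-1%R
        & forall z, ~ S z -> t z = 0%R]].

Variables (t : borel E * borel E -> R) (g : R -> R).

Definition jump_rate (x : borel E) : \bar R :=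
  \int[gamma x]_y (g (t (x, y)))%:E.

Definition embedded_kernel (x : borel E) (A : set (borel E)) : \bar R :=
  let l := jump_rate x in
  if (l == 0) || (l == +oo) then \d_x A
  else \int[gamma x]_(y in A) (g (t (x, y)) / fine l)%:E.

End target_and_base_kernel.

(* Functions on [0, +oo[ are represented by functions on [R] whose values at
   negative arguments are irrelevant. *)
Definition balancing_function (R : realType) (g : R -> R) : Prop :=
  [/\ measurable_fun (`[0%R, +oo[ : set R) g,
      g 1%R = 1%R, g 0%R = 0%R,
      forall s, (0 < s)%R -> (0 < g s)%R
    & forall s, (0 < s)%R -> g s = (s * g (s^-1))%R].

(* Exponential distribution on [0, +oo] with rate in [0, +oo]; the value at
   rate [-oo] is irrelevant. *)
Definition exp_law (R : realType) (l : \bar R) : set (\bar R) -> \bar R :=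
  match l with
  | r%:E => if r == 0%R then dirac (+oo : \bar R)
            else fun B => exponential_prob r (EFin @^-1` B)
  | _ => dirac (0 : \bar R)
  end.

Section jump_process.
Context (R : realType) (dO : measure_display) (Omega : measurableType dO)
  (E : ptopologicalType).

(* The sigma-algebra generated by the [X i], [i] in [I]. *)
Definition sigma_of (X : nat -> Omega -> borel E) (I : set nat) :
    set (set Omega) :=
  <<s \bigcup_(i in I) preimage_set_system setT (X i) measurable >>.

Variables (P : probability Omega R)
  (X : nat -> {mfun Omega >-> borel E}) (tau : nat -> {mfun Omega >-> \bar R}).

Definition markov_chain (K : borel E -> set (borel E) -> \bar R)
    (x : borel E) : Prop :=
  {ae P, forall w, X 0%N w = x} /\
  forall (n : nat) (C : set Omega) (B : set (borel E)),
    sigma_of X `I_n.+1 C -> measurable B ->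
    P (C `&` X n.+1 @^-1` B) = \int[P]_(w in C) K (X n w) B.

(* Given [X], the [tau k], k >= 1, are independent with laws
   Exp(rate (X (k - 1))); [tau 0] is not used. *)
Definition holding_times (rate : borel E -> \bar R) : Prop :=
  forall (n : nat) (C : set Omega) (B : nat -> set (\bar R)),
    sigma_of X setT C -> (forall k, measurable (B k)) ->
    P (C `&` \bigcap_(k < n) (tau k.+1 @^-1` B k)) =
    \int[P]_(w in C) \prod_(k < n) exp_law (rate (X k w)) (B k).

Definition jump_time (n : nat) (w : Omega) : \bar R :=
  \sum_(1 <= k < n.+1) tau k w.

(* [None] is the graveyard state. *)
Definition jump_process (s : R) (w : Omega) : option (borel E) :=
  if s%:E < ereal_sup [set jump_time n w | n in setT]
  then Some (X (supremum 0%N [set n | jump_time n w <= s%:E]) w)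
  else None.

End jump_process.

(* Under [P], ([X], [tau]) are the embedded chain and the holding times of the
   locally-balanced Markov jump process started from [x]. *)
Definition lbmjp (R : realType) (E : ptopologicalType)
    (gamma : R.-pker (borel E) ~> (borel E)) (t : borel E * borel E -> R)
    (g : R -> R) (dO : measure_display) (Omega : measurableType dO)
    (P : probability Omega R) (X : nat -> {mfun Omega >-> borel E})
    (tau : nat -> {mfun Omega >-> \bar R}) (x : borel E) : Prop :=
  markov_chain P X (embedded_kernel gamma t g) x /\
  holding_times P X tau (jump_rate gamma t g).

(* Main.v *)
Require Import Defs.
From HB Require Import structures.
From mathcomp Require Import all_boot all_order all_algebra.
From mathcomp Require Import all_classical all_reals all_analysis.
From mathcomp Require Import measurable_realfun.
From mathcomp Require Import ring lra.

(** Let G be the support of pi. The process is followed along the pairs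
    (X_k, tau_(k+1)) of a state and its holding time. They form a chain whose
    emissions are exponential given the states, and everything reduces to a law
    of large numbers for it.

    The balancing identity g(s) = s g(1/s) and the fact that t reverses
    pi(dx) gamma(x, dy) make the jump intensities g(t(x, y)) pi(dx) gamma(x, dy)
    symmetric ([detailed_balance]). Since g is non-decreasing, g(s) <= 1 + s, so
    the mean rate Z, the integral of lambda against pi, is finite. Hence
    eta(dx) = lambda(x) pi(dx) / Z is a probability, and symmetry makes it
    invariant for the embedded chain ([invariant_law_jump]). A state of G with
    infinite rate would be absorbing for the embedded chain; as the chain does
    not charge pi-null sets, that state would be an atom of pi, against the
    finiteness of Z ([supp_rate_lty]). As G has full measure ([polish_supp_full])
    and the chain does not charge null sets, the chain stays in G, where the
    rates are positive and finite.

    Irreducibility makes the stationary chain ergodic. A set that the chain does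
    not leave is null or full ([closed_set_01]); so the probability of a
    shift-invariant event, a harmonic function of the starting state, is almost
    everywhere constant, and after one step of the chain it is constant
    everywhere on G ([invariant_event_const]); and then the event is independent
    of every cylinder, thus of itself ([invariant_event_01]). The ergodic theorem
    needed here is proved by cutting time into blocks: if the averages of a
    nonnegative observable have almost surely a limit superior greater than a,
    then time can be covered, up to a small proportion, with blocks of bounded
    length where the average is at least a ([corrected_sum_ge]), so that the mean
    of the observable is at least a ([exceeds_le_mean]). This bounds the limit
    superior, and the limit inferior by reflection and truncation
    ([law_of_large_numbers]). By the 0-1 law, the convergence holds from each
    state of G.

    For h nonnegative and integrable, the observable h(X_k) tau_(k+1) has
    stationary mean the integral of h / lambda against eta, which is the integral
    of h against pi divided by Z ([holding_time_average]). With h = 1, the jump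
    times grow linearly: they tend to infinity, and the process does not explode.
    The integral of h along the process up to time u lies between two
    consecutive sums of h(X_k) tau_(k+1), so that its ratio to u tends to the
    quotient of the two limits, where Z cancels ([cvg_time_average]). An
    integrable f is the difference of its positive and negative parts. *)

Import Order.TTheory GRing.Theory Num.Theory.
Import numFieldNormedType.Exports.
Import HBNNSimple.
Local Open Scope classical_set_scope.
Local Open Scope ring_scope.
Local Open Scope ereal_scope.
Set Implicit Arguments.
Unset Strict Implicit.
Unset Printing Implicit Defensive.

(** * Preliminaries on integrals and kernels *)

Lemma archi_mull (R : realType) (x c : R) : (0 < c)%R ->
  exists N, forall n, (N <= n)%N -> (x <= c * n%:R)%R.
Proof.
move=> c0; exists (Num.bound (`|x| / c)) => n Nn.
rewrite mulrC -ler_pdivrMr// (le_trans (y := `|x| / c)%R)//.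
  by rewrite ler_pM2r ?invr_gt0// ler_norm.
rewrite ltW// (lt_le_trans (archi_boundP _)) ?ler_nat//.
by rewrite divr_ge0// ltW.
Qed.

Lemma eq_integral_full d (T : measurableType d) (R : realType)
    (mu : {measure set T -> \bar R}) (G D : set T) (f h : T -> \bar R) :
  measurable G -> mu (~` G) = 0 -> measurable D ->
  (forall x, 0 <= f x) -> measurable_fun setT f ->
  (forall x, 0 <= h x) -> measurable_fun setT h ->
  (forall x, G x -> f x = h x) ->
  \int[mu]_(x in D) f x = \int[mu]_(x in D) h x.
Proof.
move=> mG muG mD f0 mf h0 mh fh; apply: ge0_ae_eq_integral => //;
  [exact: measurable_funTS|exact: measurable_funTS|].
exists (~` G); split => //; first exact: measurableC.
by move=> y /= ny Gy; apply: ny => _; exact: fh.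
Qed.

Lemma le_integral_ae_eq d (T : measurableType d) (R : realType)
    (mu : {measure set T -> \bar R}) (D : set T) (f g : T -> R) :
  measurable D -> mu.-integrable D (EFin \o f) ->
  mu.-integrable D (EFin \o g) -> (forall x, D x -> (f x <= g x)%R) ->
  \int[mu]_(x in D) (f x)%:E = \int[mu]_(x in D) (g x)%:E ->
  ae_eq mu D (EFin \o f) (EFin \o g).
Proof.
move=> mD intf intg fg fgE.
have mf := measurable_int _ intf; have mg := measurable_int _ intg.
have intB : \int[mu]_(x in D) ((g x)%:E - (f x)%:E) = 0.
  rewrite (integralB mD intg intf) [X in X - _](_ : _ = \int[mu]_(x in D) (f x)%:E)//.
  by rewrite subee//; exact: (integrable_fin_num mD intf).
have /(ae_eq_integral_abs mu mD (emeasurable_funB mg mf)) :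
    \int[mu]_(x in D) `|(g x)%:E - (f x)%:E| = 0.
  rewrite -[RHS]intB; apply: eq_integral => x /set_mem Dx.
  by rewrite gee0_abs// -EFinB lee_fin subr_ge0 fg.
apply: filterS => x /= gf Dx; have /eqP := gf Dx.
by rewrite -EFinB eqe subr_eq0 => /eqP ->.
Qed.

Section probability_kernel.
Context d d' (X : measurableType d) (Y : measurableType d') (R : realType).
Variable k : R.-pker X ~> Y.

Lemma pker_le1 x A : measurable A -> k x A <= 1.
Proof.
by move=> mA; rewrite -(prob_kernel (s := k) x) le_measure ?inE.
Qed.

Lemma pker_fin_num x A : measurable A -> k x A \is a fin_num.
Proof. exact: finite_kernel_measure. Qed.

End probability_kernel.

Section integral_functional.
Context d (T : measurableType d) (R : realType).
Variables (mu : {measure set T -> \bar R}) (I : (T -> \bar R) -> \bar R).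
Hypothesis I_indic : forall A, measurable A -> I (fun x => (\1_A x)%:E) = mu A.
Hypothesis I_add : forall f g, (forall x, 0 <= f x) -> measurable_fun setT f ->
  (forall x, 0 <= g x) -> measurable_fun setT g ->
  I (fun x => f x + g x) = I f + I g.
Hypothesis I_scale : forall r f, (0 <= r)%R -> (forall x, 0 <= f x) ->
  measurable_fun setT f -> I (fun x => r%:E * f x) = r%:E * I f.
Hypothesis I_lim : forall f_ : (T -> \bar R)^nat,
  (forall n, measurable_fun setT (f_ n)) -> (forall n x, 0 <= f_ n x) ->
  (forall x, nondecreasing_seq (f_ ^~ x)) ->
  I (fun x => limn (f_ ^~ x)) = limn (fun n => I (f_ n)).

Let I_sum (s : seq R) (A : R -> set T) : (forall r, measurable (A r)) ->
  I (fun x => \sum_(r <- s) (Num.max r 0)%:E * (\1_(A r) x)%:E) =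
  \sum_(r <- s) (Num.max r 0)%:E * mu (A r).
Proof.
move=> mA.
have m1 r : measurable_fun setT (fun x : T => (Num.max r 0%R)%:E * (\1_(A r) x)%:E).
  by apply: measurable_funeM; exact/measurable_EFinP.
have p1 r x : 0 <= (Num.max r 0%R)%:E * (\1_(A r) x)%:E :> \bar R.
  by rewrite mule_ge0 ?lee_fin// le_max lexx orbT.
elim: s => [|r s ih].
  rewrite big_nil; transitivity (mu set0); last by rewrite measure0.
  rewrite -(I_indic measurable0); congr I.
  by apply/funext => x; rewrite big_nil indic0.
under eq_fun do rewrite big_cons.
rewrite I_add//; last 2 first.
- by move=> x; exact: sume_ge0.
- exact: emeasurable_sum.
rewrite ih big_cons; congr (_ + _).
rewrite I_scale ?I_indic// ?le_max ?lexx ?orbT//.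
exact/measurable_EFinP.
Qed.

Let I_nnsfun (h : {nnsfun T >-> R}) : I (EFin \o h) = \int[mu]_x (h x)%:E.
Proof.
have hE x : (h x)%:E = \sum_(r <- finmap.enum_fset (fset_set (range h)))
    (Num.max r 0)%:E * (\1_(h @^-1` [set r]) x)%:E.
  rewrite fimfunE -fsumEFin// fsbig_finite//=; apply: eq_bigr => r _.
  have [r0|r0] := leP 0%R r; first by rewrite EFinM.
  by rewrite preimage_nnfun0// indic0 mulr0 mule0.
rewrite (_ : EFin \o h = fun x => \sum_(r <- finmap.enum_fset (fset_set (range h)))
    (Num.max r 0)%:E * (\1_(h @^-1` [set r]) x)%:E); last first.
  by apply/funext => x; rewrite /= hE.
rewrite I_sum//; under eq_integral do rewrite hE.
rewrite ge0_integral_sum//; last 2 first.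
- by move=> r; apply: measurable_funeM; exact/measurable_EFinP.
- by move=> r x _; rewrite mule_ge0 ?lee_fin// le_max lexx orbT.
apply: eq_bigr => r _; rewrite ge0_integralZl//.
- by rewrite integral_indic// setIT.
- exact/measurable_EFinP.
- by rewrite lee_fin le_max lexx orbT.
Qed.

(** A functional with the algebraic and monotone-limit properties of the integral
    is determined by its values on indicators: such a functional is determined
    first on nonnegative simple functions, then on their increasing limits. The
    change-of-measure formulas below are instances. *)
Lemma ge0_integral_functional f : (forall x, 0 <= f x) ->
  measurable_fun setT f -> \int[mu]_x f x = I f.
Proof.
move=> f0 mf; pose f_ := nnsfun_approx measurableT mf.
have fE : f = fun x => limn (fun n => (f_ n x)%:E).
  by apply/funext => x; apply/esym/cvg_lim => //; exact: cvg_nnsfun_approx.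
have nd x : nondecreasing_seq (fun n => (f_ n x)%:E).
  by move=> a b ab; rewrite lee_fin; exact/lefP/nd_nnsfun_approx.
rewrite fE (I_lim (f_ := fun n => EFin \o f_ n))//; last 2 first.
- by move=> n; exact/measurable_EFinP.
- by move=> n x; rewrite lee_fin.
rewrite monotone_convergence//; last 2 first.
- by move=> n; exact/measurable_EFinP.
- by move=> n x _; rewrite lee_fin.
by congr (limn _); apply/funext => n; rewrite -I_nnsfun.
Qed.

End integral_functional.

Section density.
Context d (T : measurableType d) (R : realType).
Variables (nu : {measure set T -> \bar R}) (w : T -> R).
Hypotheses (w0 : forall x, (0 <= w x)%R) (mw : measurable_fun setT w).

(** The proofs are arguments so that the measure structure can be attached to
    the term. *)
Definition density of (forall x, (0 <= w x)%R) & measurable_fun setT w :=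
  fun A : set T => \int[nu]_(x in A) (w x)%:E.

Local Notation dens := (density w0 mw).

Let mwE : measurable_fun setT (EFin \o w). Proof. exact/measurable_EFinP. Qed.

Let w0E x : 0 <= (w x)%:E. Proof. by rewrite lee_fin. Qed.

Let dens0 : dens set0 = 0. Proof. by rewrite /density integral_set0. Qed.

Let dens_ge0 A : 0 <= dens A. Proof. exact: integral_ge0. Qed.

Let dens_sigma_additive : semi_sigma_additive dens.
Proof.
move=> F mF tF mUF; rewrite /density ge0_integral_bigcup//.
  by apply: is_cvg_nneseries => n _ _; exact: integral_ge0.
exact: measurable_funTS.
Qed.

HB.instance Definition _ := isMeasure.Build _ _ _ dens
  dens0 dens_ge0 dens_sigma_additive.

Lemma integral_density (mu : {measure set T -> \bar R}) (f : T -> \bar R) :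
  (forall A, measurable A -> mu A = \int[nu]_(x in A) (w x)%:E) ->
  (forall x, 0 <= f x) -> measurable_fun setT f ->
  \int[mu]_x f x = \int[nu]_x ((w x)%:E * f x).
Proof.
move=> muE f0 mf.
have mwM h : measurable_fun setT h ->
    measurable_fun setT (fun x => (w x)%:E * h x).
  by move=> mh; apply: (@emeasurable_funM _ _ _ _ (EFin \o w)).
apply: (@ge0_integral_functional _ _ _ mu
  (fun f => \int[nu]_x ((w x)%:E * f x))) => // {f f0 mf}.
- move=> A mA; rewrite muE// [RHS]integral_mkcond; apply: eq_integral => x _.
  rewrite patchE indicE; case: ifP => _; first by rewrite mule1.
  by rewrite mule0.
- move=> f g f0 mf g0 mg; rewrite -ge0_integralD//; last 4 first.
  + by move=> x _; rewrite mule_ge0.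
  + exact: mwM.
  + by move=> x _; rewrite mule_ge0.
  + exact: mwM.
  by apply: eq_integral => x _; rewrite ge0_muleDr.
- move=> r f r0 f0 mf; rewrite -ge0_integralZl//; last 2 first.
  + exact: mwM.
  + by move=> x _; rewrite mule_ge0.
  by apply: eq_integral => x _; rewrite muleCA.
- move=> f_ mf_ f0 nd; rewrite -monotone_convergence//; last 3 first.
  + by move=> n; exact: mwM.
  + by move=> n x _; rewrite mule_ge0.
  + by move=> x _ a b ab; rewrite lee_wpmul2l// nd.
  apply: eq_integral => x _; apply/esym/cvg_lim => //.
  apply: cvgeZl => //; apply: ereal_nondecreasing_is_cvgn; exact: nd.
Qed.

End density.

Section mixture.
Context d d' (X : measurableType d) (Y : measurableType d') (R : realType).
Variables (nu : {measure set X -> \bar R}) (k : R.-ker X ~> Y).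

Definition mixture (A : set Y) := \int[nu]_x k x A.

Let mixture0 : mixture set0 = 0.
Proof. by apply: integral0_eq => x _; rewrite measure0. Qed.

Let mixture_ge0 A : 0 <= mixture A. Proof. exact: integral_ge0. Qed.

Let mixture_sigma_additive : semi_sigma_additive mixture.
Proof.
move=> F mF tF mUF; rewrite /mixture [X in _ --> X](_ : _ = \sum_(0 <= n <oo) \int[nu]_x k x (F n)).
  by apply: is_cvg_nneseries => n _ _; exact: integral_ge0.
rewrite -integral_nneseries//; last by move=> n; exact: measurable_kernel.
apply: eq_integral => x _; rewrite measure_bigcup//.
by apply: eq_eseriesl => n; rewrite in_setT.
Qed.

HB.instance Definition _ := isMeasure.Build _ _ _ mixture
  mixture0 mixture_ge0 mixture_sigma_additive.

Lemma integral_mixture (mu : {measure set Y -> \bar R}) (f : Y -> \bar R) :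
  (forall A, measurable A -> mu A = \int[nu]_x k x A) ->
  (forall x, 0 <= f x) -> measurable_fun setT f ->
  \int[mu]_y f y = \int[nu]_x \int[k x]_y f y.
Proof.
move=> muE f0 mf.
have mint h : (forall y, 0 <= h y) -> measurable_fun setT h ->
    measurable_fun setT (fun x => \int[k x]_y h y).
  move=> h0 mh; apply: measurable_fun_integral_kernel => // U mU.
  exact: measurable_kernel.
apply: (@ge0_integral_functional _ _ _ mu
  (fun f => \int[nu]_x \int[k x]_y f y)) => // {f f0 mf}.
- move=> A mA; rewrite muE//; apply: eq_integral => x _.
  by rewrite integral_indic// setIT.
- move=> f g f0 mf g0 mg; rewrite -ge0_integralD//; last 4 first.
  + by move=> x _; exact: integral_ge0.
  + exact: mint.
  + by move=> x _; exact: integral_ge0.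
  + exact: mint.
  by apply: eq_integral => x _; rewrite ge0_integralD.
- move=> r f r0 f0 mf; rewrite -ge0_integralZl//; last 2 first.
  + exact: mint.
  + by move=> x _; exact: integral_ge0.
  by apply: eq_integral => x _; rewrite ge0_integralZl.
- move=> f_ mf_ f0 nd; rewrite -monotone_convergence//; last 3 first.
  + by move=> n; exact: mint.
  + by move=> n x _; exact: integral_ge0.
  + by move=> x _ a b ab; apply: ge0_le_integral => // y _; exact: nd.
  by apply: eq_integral => x _; rewrite monotone_convergence// => y _; exact: nd.
Qed.

End mixture.

Lemma integral_otimes (R : realType) (E : ptopologicalType)
    (pi : probability (borel E) R) (gamma : R.-pker (borel E) ~> (borel E))
    (f : borel E * borel E -> \bar R) :
  (forall z, 0 <= f z) -> measurable_fun setT f ->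
  \int[otimes pi gamma]_z f z = \int[pi]_x \int[gamma x]_y f (x, y).
Proof.
move=> f0 mf.
have mint h : (forall z, 0 <= h z) -> measurable_fun setT h ->
    measurable_fun setT (fun x => \int[gamma x]_y h (x, y)).
  by move=> h0 mh; exact: measurable_fun_integral_finite_kernel.
have msec (h : borel E * borel E -> \bar R) (x : borel E) :
    measurable_fun setT h -> measurable_fun setT (fun y => h (x, y)).
  by move=> mh; exact: (measurableT_comp mh (pair1_measurable x)).
apply: (@ge0_integral_functional _ _ _ (otimes pi gamma)
  (fun f => \int[pi]_x \int[gamma x]_y f (x, y))) => // {f f0 mf}.
- move=> A mA; apply: eq_integral => x _.
  rewrite (_ : (fun y => (\1_A (x, y))%:E) = EFin \o \1_(xsection A x)).
    by rewrite integral_indic ?setIT//; exact: measurable_xsection.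
  by apply/funext => y; rewrite /= !indicE mem_xsection.
- move=> f g f0 mf g0 mg; rewrite -ge0_integralD//; last 4 first.
  + by move=> x _; exact: integral_ge0.
  + exact: mint.
  + by move=> x _; exact: integral_ge0.
  + exact: mint.
  by apply: eq_integral => x _; rewrite ge0_integralD//; exact: msec.
- move=> r f r0 f0 mf; rewrite -ge0_integralZl//; last 2 first.
  + exact: mint.
  + by move=> x _; exact: integral_ge0.
  by apply: eq_integral => x _; rewrite ge0_integralZl//; exact: msec.
- move=> f_ mf_ f0 nd; rewrite -monotone_convergence//; last 3 first.
  + by move=> n; exact: mint.
  + by move=> n x _; exact: integral_ge0.
  + move=> x _ a b ab; apply: ge0_le_integral => //; try exact: msec.
    by move=> y _; exact: nd.
  apply: eq_integral => x _; rewrite monotone_convergence//.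
  by move=> n; exact: msec.
Qed.

(** * The space of trajectories *)

Section path_space.
Context d d' (E : measurableType d) (F : measurableType d').
Implicit Types (U : nat -> set E) (V : nat -> set F).

Definition cylinder n U V : set (nat -> E * F) :=
  [set w | forall k, (k < n)%N -> U k (w k).1 /\ V k (w k).2].

Definition cylinders : set (set (nat -> E * F)) :=
  [set C | exists n U V, [/\ forall k, measurable (U k),
     forall k, measurable (V k) & C = cylinder n U V]].

(** Trajectories of pairs (state, emission); the emission will be the holding
    time of the visit. *)
Definition path_space := g_sigma_algebraType cylinders.

HB.instance Definition _ := Measurable.on path_space.

Definition shift (w : path_space) : path_space := fun k => w k.+1.

Lemma measurable_cylinder n U V : (forall k, measurable (U k)) ->
  (forall k, measurable (V k)) ->
  measurable (cylinder n U V : set path_space).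
Proof. by move=> mU mV; apply: sub_sigma_algebra; exists n, U, V. Qed.

Lemma setI_cylinders : setI_closed cylinders.
Proof.
move=> _ _ [n [U [V [mU mV ->]]]] [m [U' [V' [mU' mV' ->]]]].
pose mask T (A B : nat -> set T) k :=
  (if (k < n)%N then A k else setT) `&` (if (k < m)%N then B k else setT).
exists (maxn n m), (mask _ U U'), (mask _ V V'); split.
- by move=> k; apply: measurableI; case: ifP.
- by move=> k; apply: measurableI; case: ifP.
- apply/seteqP; split => w.
    move=> [wn wm] k _; rewrite /mask; case: ifP => kn; case: ifP => km;
      by do ?split => //; (apply wn || apply wm).
  move=> wnm; split => k kn; have := wnm k; rewrite leq_max kn ?orbT.
    by move=> /(_ isT); rewrite /mask kn => -[[? _] [? _]].
  by move=> /(_ isT); rewrite /mask kn => -[[_ ?] [_ ?]].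
Qed.

(** Cylinders form a pi-system that generates the sigma-algebra, so laws of
    trajectories are compared on finitely many coordinates. *)
Lemma path_measure_unique (R : realType)
    (m1 m2 : {measure set path_space -> \bar R}) :
  (forall n U V, (forall k, measurable (U k)) -> (forall k, measurable (V k)) ->
    m1 (cylinder n U V) = m2 (cylinder n U V)) ->
  m1 setT < +oo -> forall A, measurable A -> m1 A = m2 A.
Proof.
move=> m12 m1oo A mA.
apply: (@measure_unique _ R path_space cylinders (fun=> setT) erefl setI_cylinders _ _ m1 m2 _ (fun=> m1oo) A mA).
- move=> _; exists 0%N, (fun=> setT), (fun=> setT); split => //.
  by apply/seteqP; split.
- by apply/seteqP; split => // w _; exists 0%N.
- by move=> _ [n [U [V [mU mV ->]]]]; exact: m12.
Qed.

Lemma measurable_coordinate k :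
  measurable_fun setT (fun w : path_space => w k).
Proof.
rewrite (_ : (fun w => w k) = (fun w => ((w k).1, (w k).2))); last first.
  by apply/funext => w; case: (w k).
apply: measurable_fun_pair => _ B mB; rewrite setTI.
  rewrite (_ : _ @^-1` _ =
    cylinder k.+1 (fun j => if j == k then B else setT) (fun=> setT)).
    by apply: measurable_cylinder => // j; case: ifP.
  apply/seteqP; split => w; last by move=> /(_ k (ltnSn k)); rewrite eqxx => -[].
  by move=> Bw j _; split => //; case: eqP => // ->.
rewrite (_ : _ @^-1` _ =
  cylinder k.+1 (fun=> setT) (fun j => if j == k then B else setT)).
  by apply: measurable_cylinder => // j; case: ifP.
apply/seteqP; split => w; last by move=> /(_ k (ltnSn k)); rewrite eqxx => -[].
by move=> Bw j _; split => //; case: eqP => // ->.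
Qed.

Lemma measurable_to_path d0 (T : measurableType d0) (W : T -> path_space) :
  (forall k, measurable_fun setT (fun x => W x k)) -> measurable_fun setT W.
Proof.
move=> mW; apply: (@measurability _ _ T path_space setT W cylinders erefl).
move=> _ [_ [n [U [V [mU mV ->]]]] <-]; rewrite setTI.
rewrite (_ : _ @^-1` _ =
  \bigcap_(k in `I_n) ((fun x => W x k) @^-1` (U k `*` V k))).
  apply: bigcap_measurableType => k _; rewrite -[X in measurable X]setTI.
  by apply: mW => //; exact: measurableX.
by apply/seteqP; split.
Qed.

Lemma measurable_shift : measurable_fun setT shift.
Proof. by apply: measurable_to_path => k; exact: measurable_coordinate. Qed.

End path_space.
Arguments path_space {d d'} E F.
Arguments shift {d d' E F}.

(** * Chains with emissions: the Markov property *)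

Section ergodic_chain.
Context d d' (E : measurableType d) (F : measurableType d') (R : realType).
Variables (K : R.-pker E ~> E) (e : R.-pker E ~> F).
Implicit Types (U : nat -> set E) (V : nat -> set F).

(** The probability of a cylinder when the states form a Markov chain of kernel
    [K] started at [x] and, given the states, the emissions are independent of
    laws [e]. *)
Fixpoint cylinder_law n U V (x : E) : \bar R :=
  if n is m.+1 then
    (\1_(U 0%N) x)%:E * e x (V 0%N) *
    \int[K x]_y cylinder_law m (U \o S) (V \o S) y
  else 1.

Lemma cylinder_law_ge0 n U V x : 0 <= cylinder_law n U V x.
Proof.
elim: n U V x => //= n ih U V x.
by rewrite !mule_ge0// ?lee_fin// integral_ge0.
Qed.

Lemma measurable_cylinder_law n U V : (forall k, measurable (U k)) ->
  (forall k, measurable (V k)) -> measurable_fun setT (cylinder_law n U V).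
Proof.
elim: n U V => //= n ih U V mU mV.
apply: emeasurable_funM; last first.
  apply: measurable_fun_integral_kernel.
  - by move=> B mB; exact: measurable_kernel.
  - by move=> y; exact: cylinder_law_ge0.
  - by apply: ih => k /=.
apply: emeasurable_funM; last exact: measurable_kernel.
exact/measurable_EFinP.
Qed.

Variables (G : set E) (p : R.-pker E ~> path_space E F).
Hypothesis mG : measurable G.
Hypothesis KG : forall x, G x -> K x (~` G) = 0.
Hypothesis pE : forall x, G x -> forall n U V, (forall k, measurable (U k)) ->
  (forall k, measurable (V k)) -> p x (cylinder n U V) = cylinder_law n U V x.

(** The chain does not leave [G], so only the values on [G] matter. *)
Lemma eq_integral_K x (f h : E -> \bar R) : G x ->
  (forall y, 0 <= f y) -> measurable_fun setT f ->
  (forall y, 0 <= h y) -> measurable_fun setT h ->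
  (forall y, G y -> f y = h y) -> \int[K x]_y f y = \int[K x]_y h y.
Proof.
by move=> Gx f0 mf h0 mh; exact: (eq_integral_full mG (KG Gx)).
Qed.

(** The Markov property at time 1, for every event of the future: both sides are
    finite measures in [A], and on cylinders the identity is the recursion
    defining [cylinder_law]. *)
Lemma law_step x B C A : G x -> measurable B -> measurable C ->
  measurable A ->
  p x ([set w | B (w 0%N).1 /\ C (w 0%N).2] `&` shift @^-1` A) =
  (\1_B x)%:E * e x C * \int[K x]_y p y A.
Proof.
move=> Gx mB mC mA.
pose D : set (path_space E F) := [set w | B (w 0%N).1 /\ C (w 0%N).2].
have DE : D = cylinder 1 (fun=> B) (fun=> C).
  by apply/seteqP; split => w; [move=> Dw [|]//|move=> /(_ 0%N isT)].
have mD : measurable D by rewrite DE; exact: measurable_cylinder.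
have msh := @measurable_shift _ _ E F.
have c0 : (0 <= \1_B x * fine (e x C))%R by rewrite mulr_ge0 ?fine_ge0.
have eC : e x C \is a fin_num by exact: pker_fin_num.
transitivity (pushforward (mrestr (p x) mD) shift A).
  by rewrite /pushforward /mrestr setIC.
transitivity (mscale (NngNum c0) (mixture (K x) p) A); last first.
  by rewrite /mscale/= EFinM fineK.
apply: (path_measure_unique (m1 := pushforward (mrestr (p x) mD) shift)
  (m2 := mscale (NngNum c0) (mixture (K x) p))) => // [n U V mU mV|]; last first.
  rewrite /= /pushforward /mrestr (le_lt_trans _ (ltry 1))// pker_le1//.
  by rewrite preimage_setT setTI.
rewrite /= /pushforward /mrestr /mscale /mixture /= EFinM fineK//.
transitivity (p x (cylinder n.+1 (fun k => if k is m.+1 then U m else B)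
   (fun k => if k is m.+1 then V m else C))).
  congr (p x _); apply/seteqP; split => w.
    by move=> [wn Dw] [|k]// kn; exact: wn.
  by move=> wn; split; [move=> k kn; exact: (wn k.+1)|exact: (wn 0%N)].
rewrite pE//; [|by case|by case].
rewrite /=; congr (_ * _); apply: eq_integral_K => //.
- by move=> y; exact: cylinder_law_ge0.
- exact: measurable_cylinder_law.
- apply: measurable_kernel; exact: measurable_cylinder.
- by move=> y Gy; rewrite pE.
Qed.

Lemma law_shift x A : G x -> measurable A ->
  p x (shift @^-1` A) = \int[K x]_y p y A.
Proof.
move=> Gx mA; have := @law_step x setT setT A Gx measurableT measurableT mA.
rewrite indicT prob_kernel !mul1e => <-; congr (p x _).
by rewrite (_ : [set _ | _] = setT) ?setTI//; apply/seteqP; split.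
Qed.

Lemma law_start x B C : G x -> measurable B -> measurable C ->
  p x [set w | B (w 0%N).1 /\ C (w 0%N).2] = (\1_B x)%:E * e x C.
Proof.
move=> Gx mB mC; have := law_step Gx mB mC measurableT.
under eq_integral do rewrite prob_kernel.
by rewrite integral_cst// prob_kernel !mule1 preimage_setT setIT.
Qed.

(** On rectangles this is [law_start]; rectangles generate the product
    sigma-algebra. *)
Lemma law_first x (N : set (E * F)) : G x -> measurable N ->
  p x [set w | N (w 0%N)] = e x (xsection N x).
Proof.
move=> Gx mN.
have mc := @measurable_coordinate _ _ E F 0%N.
have mx : measurable_fun setT (fun s : F => (x, s)) := pair1_measurable x.
rewrite xsectionE.
apply: (@measure_unique _ R (E * F)%type
  [set A `*` B | A in measurable & B in measurable] (fun=> setT) _ _ _ _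
  (pushforward (p x) (fun w : path_space E F => w 0%N))
  (pushforward (e x) (fun s => (x, s))) _ _ N mN).
- by rewrite measurable_prod_measurableType.
- move=> _ _ [A mA [B mB <-]] [A' mA' [B' mB' <-]].
  exists (A `&` A'); first exact: measurableI.
  by exists (B `&` B'); [exact: measurableI|rewrite setXI].
- by move=> _; exists setT => //; exists setT => //; rewrite setXTT.
- by apply/seteqP; split => // w _; exists 0%N.
- move=> _ [A mA [B mB <-]] /=; rewrite /pushforward.
  transitivity ((\1_A x)%:E * e x B); first exact: law_start.
  rewrite indicE; have [xA|xA] := boolP (x \in A).
    rewrite mul1e; congr (e x _); apply/seteqP; split => s //=.
      by move=> ?; split => //; rewrite inE in xA.
    by case.
  rewrite mul0e [X in e x X](_ : _ = set0) ?measure0//.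
  by apply/seteqP; split => s //= [/mem_set]; rewrite (negbTE xA).
- move=> _; rewrite /= /pushforward (le_lt_trans _ (ltry 1))// pker_le1//.
  by rewrite preimage_setT.
Qed.

(** Null sets of the pair (state, emission) stay null at every later time,
    because the transitions do not leave [G]. *)
Lemma law_coordinate_null (N : set (E * F)) : measurable N ->
  (forall x, G x -> e x (xsection N x) = 0) ->
  forall n x, G x -> p x [set w | N (w n)] = 0.
Proof.
move=> mN N0; elim=> [|n ih] x Gx; first by rewrite law_first// N0.
have mNn : measurable [set w : path_space E F | N (w n)].
  by rewrite -[X in measurable X]setTI; exact: measurable_coordinate.
rewrite (_ : [set _ | _] = shift @^-1` [set w | N (w n)])//.
rewrite law_shift//; transitivity (\int[K x]_(y in setT) (cst 0 y : \bar R)).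
  by apply: eq_integral_K => //; exact: measurable_kernel.
exact: integral0.
Qed.

(** * Ergodicity: closed sets and shift-invariant events *)

Variable mu : probability E R.
Hypothesis mu_inv : forall A, measurable A -> \int[mu]_x K x A = mu A.
Hypothesis muG : mu (~` G) = 0.
Hypothesis K_ac : forall x A, G x -> measurable A -> mu A = 0 -> K x A = 0.
Let muT : (mu : {measure set E -> \bar R}) setT = 1. Proof. exact: probability_setT. Qed.

Variable phi : {measure set E -> \bar R}.
Hypothesis phi_gt0 : 0 < phi setT.
Hypothesis phi_irr : forall x B, G x -> measurable B -> 0 < phi B ->
  exists n, 0 < p x [set w | B (w n).1].

Lemma invariant_integral f : (forall x, 0 <= f x) -> measurable_fun setT f ->
  \int[mu]_x \int[K x]_y f y = \int[mu]_x f x.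
Proof.
by move=> f0 mf; rewrite -(@integral_mixture _ _ _ _ _ mu K mu)// => A mA; rewrite mu_inv.
Qed.

Let m_visit n B : measurable B ->
  measurable [set w : path_space E F | B (w n).1].
Proof.
move=> mB; rewrite -[X in measurable X]setTI.
exact: (measurableT_comp (@measurable_fst _ _ E F) (measurable_coordinate n)).
Qed.

Let m_visit_law n B : measurable B ->
  measurable_fun setT (fun x => p x [set w | B (w n).1]).
Proof. by move=> mB; apply: measurable_kernel; exact: m_visit. Qed.

Lemma integral_full D f : measurable D -> mu (~` D) = 0 ->
  (forall x, 0 <= f x) -> measurable_fun setT f ->
  \int[mu]_(x in D) f x = \int[mu]_x f x.
Proof.
move=> mD muD f0 mf.
rewrite [RHS](ge0_negligible_integral (measurableC mD))//.
by rewrite setTD setCK.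
Qed.

(** If almost no state of [A] leads out of [A] in one step, then almost no state
    leads out at any later time: a chain that is out of [A] at time [n.+1] left
    it at its first step, or was at time 1 in a state of [A] that leads out in
    [n] steps; and by invariance the law of the chain at time 1, started from
    [mu] restricted to [A], is dominated by [mu]. *)
Lemma closed_set_no_escape A : measurable A -> A `<=` G ->
  \int[mu]_(x in A) K x (~` A) = 0 ->
  forall n, \int[mu]_(x in A) p x [set w | (~` A) (w n).1] = 0.
Proof.
move=> mA AG KA; have mCA := measurableC mA.
elim=> [|n ih].
  apply: integral0_eq => x Ax.
  have -> : [set w | (~` A) (w 0%N).1] =
      [set w : path_space E F | (~` A) (w 0%N).1 /\ setT (w 0%N).2].
    by apply/seteqP; split => w //= -[].
  rewrite law_start//; last exact: AG.
  by rewrite indicE memNset ?mul0e//; exact.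
apply/eqP; rewrite eq_le integral_ge0// andbT.
apply: (@le_trans _ _ (\int[mu]_(x in A)
    (K x (~` A) + \int[K x]_y (p y [set w | (~` A) (w n).1] * (\1_A y)%:E)))).
  apply: ge0_le_integral => //.
  - by apply: measurable_funTS; exact: m_visit_law.
  - apply: measurable_funTS; apply: emeasurable_funD; first exact: measurable_kernel.
    apply: measurable_fun_integral_kernel => //.
    + by move=> B mB; exact: measurable_kernel.
    + apply: emeasurable_funM; first exact: m_visit_law.
      exact/measurable_EFinP.
  move=> x Ax; rewrite -[X in p x X]/(shift @^-1` [set w | (~` A) (w n).1]).
  rewrite law_shift//; [|exact: AG|exact: m_visit].
  have -> : K x (~` A) = \int[K x]_y (\1_(~` A) y)%:E.
    by rewrite integral_indic// setIT.
  rewrite -ge0_integralD//; last 2 first.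
  + exact/measurable_EFinP.
  + apply: emeasurable_funM; first exact: m_visit_law.
    exact/measurable_EFinP.
  apply: ge0_le_integral => //.
  - exact: m_visit_law.
  - apply: emeasurable_funD; first exact/measurable_EFinP.
    apply: emeasurable_funM; first exact: m_visit_law.
    exact/measurable_EFinP.
  move=> y _; rewrite indicC !indicE; have [yA|yA] := boolP (y \in A).
    by rewrite /= add0e mule1.
  by rewrite /= mule0 adde0 pker_le1//; exact: (m_visit n mCA).
have mv : measurable_fun setT
    (fun y => p y [set w | (~` A) (w n).1] * (\1_A y)%:E).
  apply: emeasurable_funM; first exact: m_visit_law.
  exact/measurable_EFinP.
rewrite ge0_integralD//; last 3 first.
- by apply: measurable_funTS; exact: measurable_kernel.
- by move=> x _; exact: integral_ge0.
- apply: measurable_funTS; apply: measurable_fun_integral_kernel => //.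
  by move=> B mB; exact: measurable_kernel.
rewrite KA add0e -ih [leRHS]integral_mkcond.
rewrite [leRHS](_ : _ = \int[mu]_y (p y [set w | (~` A) (w n).1] * (\1_A y)%:E)).
  rewrite -invariant_integral//; apply: ge0_subset_integral => //.
  apply: measurable_fun_integral_kernel => //.
    by move=> B mB; exact: measurable_kernel.
  by move=> x _; exact: integral_ge0.
apply: eq_integral => y _; rewrite patchE indicE; case: ifP => _; first by rewrite mule1.
by rewrite mule0.
Qed.

(** A closed set is almost surely not left, whereas irreducibility makes every
    state of it reach a complement charged by [phi]. *)
Lemma closed_set_reached_null A : measurable A -> A `<=` G ->
  \int[mu]_(x in A) K x (~` A) = 0 -> 0 < phi (~` A) -> mu A = 0.
Proof.
move=> mA AG KA phiA; have esc := closed_set_no_escape mA AG KA.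
have mCA := measurableC mA.
have mf n : measurable_fun A (fun x => p x [set w | (~` A) (w n).1]).
  by apply: measurable_funTS; exact: m_visit_law.
have ae_n n : ae_eq mu A (fun x => p x [set w | (~` A) (w n).1]) (cst 0).
  apply/(ae_eq_integral_abs mu mA (mf n)).
  by rewrite -(esc n); apply: eq_integral => x _; rewrite gee0_abs.
have /ae_foralln : forall n, \forall x \ae mu, A x ->
    p x [set w | (~` A) (w n).1] = 0.
  by move=> n; exact: ae_n.
move=> [N [mN muN AN]].
apply: (subset_measure0 mA mN) => // x Ax; apply: AN => /= h.
have [n] := phi_irr (AG _ Ax) mCA phiA.
by rewrite (h n Ax) ltxx.
Qed.

(** The complement of a closed set is closed too, up to a null set, since [mu] is
    a probability invariant by [K]: as much mass enters [A] as leaves it. And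
    [phi] charges the complement of [A] or that of [G `\` A]. *)
Lemma closed_set_01 A : measurable A -> A `<=` G ->
  \int[mu]_(x in A) K x (~` A) = 0 -> mu A = 0 \/ mu (G `\` A) = 0.
Proof.
move=> mA AG KA; have mCA := measurableC mA.
have mB : measurable (G `\` A) by exact: measurableD.
have mKA : measurable_fun setT (fun x => K x A) by exact: measurable_kernel.
have [phiA|phiA] := boolP (0 < phi (~` A)).
  by left; exact: closed_set_reached_null.
right; apply: closed_set_reached_null => //; last first.
  rewrite lt_neqAle measure_ge0 andbT eq_sym; apply/negP => /eqP phiB.
  move: phiA; rewrite -leNgt => phiA; have : phi setT <= 0.
    rewrite -(setUv (~` A)) setCK (le_trans (measureU2 _ _ _))//.
    rewrite -[leRHS]adde0 leeD// -phiB le_measure ?inE//.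
      exact: measurableC.
    by move=> x Ax [_]; apply.
  by rewrite leNgt phi_gt0.
have splitA : \int[mu]_(x in A) K x A = mu A.
  rewrite -[LHS]adde0 -KA -ge0_integralD//; last 2 first.
  - exact: measurable_funTS.
  - by apply: measurable_funTS; exact: measurable_kernel.
  rewrite -[RHS]mul1e -integral_cst//; apply: eq_integral => x _.
  by rewrite -measureU ?setUv//; [exact: prob_kernel|exact: setICr].
have KCA0 : \int[mu]_(x in ~` A) K x A = 0.
  have : \int[mu]_(x in ~` A) K x A + mu A = mu A.
    rewrite -[RHS]mu_inv// -[in RHS](setUv A) ge0_integral_setU//=.
    - by rewrite splitA addeC.
    - by rewrite setUv.
    - exact/disj_setPCl.
  move=> h; rewrite -[LHS](addeK (x := mu A)) ?fin_num_measure// h.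
  by rewrite subee// fin_num_measure.
apply/eqP; rewrite eq_le integral_ge0// andbT -KCA0.
apply: (@le_trans _ _ (\int[mu]_(x in G `\` A) K x A)).
  apply: ge0_le_integral => //.
  - by apply: measurable_funTS; apply: measurable_kernel; exact: measurableC.
  - exact: measurable_funTS.
  move=> x [Gx _]; rewrite setDE setCI setCK.
  apply: (@le_trans _ _ (K x (~` G) + K x A)); last by rewrite KG// add0e.
  by apply: measureU2 => //; exact: measurableC.
apply: ge0_subset_integral => //; first exact: measurable_funTS.
Qed.

(** The probability [h x] of a shift-invariant event is a harmonic function of
    the starting state. Jensen for the concave function [min(., c)], with [c] the
    mean of [h], shows that the set where [h >= c] is closed, hence null or full;
    in both cases [h] lies on one side of its mean, so that [h = c] almost
    everywhere. One step of the chain, which does not see null sets, makes this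
    true at every state. *)
Lemma invariant_event_const S : measurable S -> shift @^-1` S = S ->
  exists c : R, forall x, G x -> p x S = c%:E.
Proof.
move=> mS SS; pose h x := fine (p x S).
have hE x : (h x)%:E = p x S by rewrite /h fineK// pker_fin_num.
have h0 x : (0 <= h x)%R by rewrite -lee_fin hE.
have h1 x : (h x <= 1)%R by rewrite -lee_fin hE pker_le1.
have mh : measurable_fun setT h.
  by apply: measurableT_comp => //; exact: measurable_kernel.
have harm x : G x -> \int[K x]_y (h y)%:E = (h x)%:E.
  move=> Gx; under eq_integral do rewrite hE.
  by rewrite hE -law_shift// SS.
pose c := fine (\int[mu]_x (h x)%:E).
have intb (nu : {measure set E -> \bar R}) (f : E -> R) D : nu setT = 1 ->
    measurable D -> measurable_fun setT f -> (forall x, 0 <= f x <= 1)%R ->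
    nu.-integrable D (EFin \o f).
  move=> nu1 mD mf f01; apply/integrableP; split.
    exact/measurable_EFinP/measurable_funTS.
  apply: (@le_lt_trans _ _ (\int[nu]_(x in setT) (cst 1 x))); last first.
    by rewrite integral_cst// mul1e nu1 ltry.
  apply: (@le_trans _ _ (\int[nu]_x `|(f x)%:E|)).
    apply: ge0_subset_integral => //.
    by apply: measurableT_comp => //; exact/measurable_EFinP.
  apply: ge0_le_integral => //.
    by apply: measurableT_comp => //; exact/measurable_EFinP.
  by move=> x _; rewrite gee0_abs lee_fin; case/andP: (f01 x).
have inth D : measurable D -> mu.-integrable D (EFin \o h).
  move=> mD; apply: intb => //.
  by move=> x; rewrite h0 h1.
have cE : c%:E = \int[mu]_x (h x)%:E.
  by rewrite /c fineK//; exact: (integrable_fin_num measurableT (inth _ measurableT)).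
have c01 : (0 <= c <= 1)%R.
  rewrite -!lee_fin cE integral_ge0//=; last by move=> x _; rewrite lee_fin.
  apply: (@le_trans _ _ (\int[mu]_(x in setT) (cst 1 x))).
    apply: ge0_le_integral => // [x _||x _]; rewrite ?lee_fin//.
    exact/measurable_EFinP.
  by rewrite integral_cst// mul1e muT.
pose u x := Num.min (h x) c.
have mu_ : measurable_fun setT u by exact: measurable_minr.
have u01 x : (0 <= u x <= 1)%R.
  by rewrite /u le_min h0 ge_min h1 /=; case/andP: c01 => ->.
pose A := G `&` [set x | (c <= h x)%R].
have mge : measurable [set x | (c <= h x)%R].
  rewrite -[X in measurable X]setTI.
  have := @measurable_fun_ler _ E R setT (cst c) h (measurable_cst _) mh.
  exact.
have mA : measurable A by exact: measurableI.
have uE x : 0 <= (u x)%:E by rewrite lee_fin; case/andP: (u01 x).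
have muE : measurable_fun setT (EFin \o u) by exact/measurable_EFinP.
pose v x := fine (\int[K x]_y (u y)%:E).
have vle1 x : 0 <= \int[K x]_y (u y)%:E <= 1.
  rewrite integral_ge0//=; apply: (@le_trans _ _ (\int[K x]_(y in setT) (cst 1 y))).
    by apply: ge0_le_integral => // y _; rewrite lee_fin; case/andP: (u01 y).
  by rewrite integral_cst// mul1e pker_le1.
have vE x : (v x)%:E = \int[K x]_y (u y)%:E.
  rewrite /v fineK// ge0_fin_numE; last by case/andP: (vle1 x).
  by case/andP: (vle1 x) => _ /le_lt_trans; apply; exact: ltry.
have v01 x : (0 <= v x <= 1)%R by rewrite -!lee_fin vE.
have mv : measurable_fun setT v.
  apply: measurableT_comp => //; apply: measurable_fun_integral_kernel => //.
  by move=> B mB; exact: measurable_kernel.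
have vu x : G x -> (v x <= u x)%R.
  move=> Gx; rewrite /u le_min -!lee_fin vE -(harm x)//; apply/andP; split.
    apply: ge0_le_integral => //; first exact/measurable_EFinP.
    by move=> y _; rewrite lee_fin ge_min lexx.
  apply: (@le_trans _ _ (\int[K x]_(y in setT) (cst c%:E y))).
    apply: ge0_le_integral => // y _.
    by rewrite lee_fin ge_min lexx orbT.
  by rewrite integral_cst// prob_kernel mule1.
(* [K u <= u], and both have the same mean by invariance *)
have uv : ae_eq mu G (EFin \o v) (EFin \o u).
  apply: le_integral_ae_eq => //.
  - by apply: intb.
  - by apply: intb.
  rewrite !(@integral_full G)//.
  - by under eq_integral do rewrite vE; rewrite invariant_integral.
  - by move=> x; rewrite lee_fin; case/andP: (v01 x).
  - exact/measurable_EFinP.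
(* where [K u = u = c], the bound [u <= c] is attained at almost every next
   state, which is thus again in [A] *)
have closedA x : A x -> v x = u x -> K x (~` A) = 0.
  move=> [Gx /= ch] vxu.
  have : ae_eq (K x) setT (EFin \o u) (EFin \o cst c).
    apply: le_integral_ae_eq => //.
    - by apply: intb => //; exact: prob_kernel.
    - by apply: intb => //; exact: prob_kernel.
    - by move=> y _; rewrite ge_min lexx orbT.
    rewrite -vE vxu /u (min_idPr ch).
    transitivity (\int[K x]_(y in setT) (cst c%:E y)) => //.
    by rewrite integral_cst// prob_kernel mule1.
  move=> [N [mN KN uN]].
  have KNG : K x (N `|` ~` G) = 0.
    rewrite measureU0 ?KG//; exact: measurableC.
  apply: (@subset_measure0 _ _ _ (K x) _ (N `|` ~` G)) => //.
  - exact: measurableC.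
  - by apply: measurableU => //; exact: measurableC.
  - move=> y; rewrite /A /= not_andP => -[nGy|nch]; first by right.
    left; apply: uN => /= /(_ I) [ucE]; apply: nch.
    by move: ucE => /eqP; rewrite /u eq_minr.
have KA0 : \int[mu]_(x in A) K x (~` A) = 0.
  have mKA : measurable_fun A (fun x => K x (~` A)).
    by apply: measurable_funTS; apply: measurable_kernel; exact: measurableC.
  have /(ae_eq_integral_abs mu mA mKA) :
      ae_eq mu A (fun x => K x (~` A)) (cst 0).
    apply: filterS uv => x /= uvx Ax; apply: closedA => //.
    by have [] := uvx (proj1 Ax).
  by move=> <-; apply: eq_integral => x _; rewrite gee0_abs.
have hc D : measurable D -> mu (~` D) = 0 ->
    (forall x, D x -> (h x <= c)%R) \/ (forall x, D x -> (c <= h x)%R) ->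
    mu.-negligible [set x | h x != c].
  move=> mD muD Dhc.
  have intc : mu.-integrable D (EFin \o cst c).
    by apply: intb.
  have hcD : \int[mu]_(x in D) (h x)%:E = \int[mu]_(x in D) ((cst c) x)%:E.
    rewrite !(@integral_full D)//.
    - rewrite -cE; transitivity (\int[mu]_(y in setT) (cst c%:E y)) => //.
      by rewrite integral_cst// muT mule1.
    - by move=> x; rewrite lee_fin; case/andP: c01.
    - by apply/measurable_EFinP; exact: measurable_cst.
    - exact/measurable_EFinP.
  have aeD : \forall x \ae mu, D x -> h x = c.
    case: Dhc => Dhc.
      have := le_integral_ae_eq mD (inth _ mD) intc Dhc hcD.
      by apply: filterS => x /= hx Dx; have [] := hx Dx.
    have := le_integral_ae_eq mD intc (inth _ mD) Dhc (esym hcD).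
    by apply: filterS => x /= hx Dx; have [] := hx Dx.
  have aeT : \forall x \ae mu, D x.
    by exists (~` D); split => //; exact: measurableC.
  have : \forall x \ae mu, h x = c by apply: filterS2 aeD aeT => x; apply.
  apply: negligibleS => x /= hx; exact/eqP.
have [N [mN muN hN]] : mu.-negligible [set x | h x != c].
  have mAc : measurable (G `\` A) by exact: measurableD.
  have [muA|muA] := closed_set_01 mA (@subIsetl _ _ _) KA0.
    apply: (hc (G `\` A)) => //.
      by rewrite setDE setCI setCK measureU0//; exact: measurableC.
    by left => x [Gx] /= /not_andP[//|/negP]; rewrite -ltNge => /ltW.
  apply: (hc A) => //; last by right => x [].
  rewrite (_ : ~` A = ~` G `|` (G `\` A)) ?measureU0//; first exact: measurableC.
  apply/seteqP; split => x /=; first by have [|] := pselect (G x); [right|left].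
  by move=> [nGx [/nGx]|[]].
exists c => x Gx; rewrite -hE -harm//.
transitivity (\int[K x]_(y in setT) (cst c%:E y)); last first.
  by rewrite integral_cst// prob_kernel mule1.
apply: ge0_ae_eq_integral => //.
- exact/measurable_EFinP.
- by move=> y _; rewrite lee_fin.
- by move=> y _; rewrite lee_fin; case/andP: c01.
exists N; split => //; first exact: K_ac.
by move=> y /= nh; apply: hN => /=; apply/eqP => hy; apply: nh => _; rewrite hy.
Qed.

(** A shift-invariant event is independent of every cylinder, because its
    probability given the states visited so far is the same constant whatever
    these states; hence it is independent of itself. *)
Lemma invariant_event_01 S : measurable S -> shift @^-1` S = S ->
  (forall x, G x -> p x S = 0) \/ (forall x, G x -> p x S = 1).
Proof.
move=> mS SS; have [c pc] := invariant_event_const mS SS.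
have [x0 Gx0] : exists x, G x.
  apply/not_existsP => nG; suff : mu (~` G) = 1 by rewrite muG => /eqP; rewrite eq_sym onee_eq0.
  by rewrite (_ : ~` G = setT)//; apply/seteqP; split => // x _; exact: nG.
have c0 : (0 <= c)%R by rewrite -lee_fin -(pc _ Gx0).
have cyl n U V x : (forall k, measurable (U k)) ->
    (forall k, measurable (V k)) -> G x ->
    p x (cylinder n U V `&` S) = c%:E * p x (cylinder n U V).
  elim: n U V x => [|n ih] U V x mU mV Gx.
    rewrite (_ : cylinder _ _ _ = setT) ?setTI ?pc// ?prob_kernel ?mule1//.
    by apply/seteqP; split.
  have cylS : cylinder n.+1 U V = [set w : path_space E F |
      U 0%N (w 0%N).1 /\ V 0%N (w 0%N).2] `&`
      shift @^-1` (cylinder n (U \o succn) (V \o succn)).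
    apply/seteqP; split => w /= h; first by split; [exact: (h 0%N)|move=> k kn; exact: h].
    by case: h => h0 h [|k]// kn; exact: h.
  have mc : measurable (cylinder n (U \o succn) (V \o succn) : set (path_space E F)).
    by apply: measurable_cylinder => k /=.
  rewrite cylS -[in LHS]SS -setIA -preimage_setI.
  rewrite !law_step//; last exact: measurableI.
  rewrite muleCA; congr (_ * _); rewrite -ge0_integralZl//; last exact: measurable_kernel.
  apply: eq_integral_K => //.
  - by apply: measurable_kernel; exact: measurableI.
  - by move=> y; rewrite mule_ge0.
  - by apply: measurable_funeM; exact: measurable_kernel.
  - by move=> y Gy; apply: ih => // k /=.
have cc x : G x -> p x S = c%:E * p x S.
  move=> Gx; rewrite -{1}(setIid S).
  apply: (path_measure_unique (m1 := mrestr (p x) mS)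
    (m2 := mscale (NngNum c0) (p x))) => // [n U V mU mV|]; first exact: cyl.
  by rewrite /= /mrestr (le_lt_trans _ (ltry 1))// pker_le1// setTI.
(* independence of itself reads [c = c * c] *)
have : (c * (c - 1) = 0)%R.
  have := cc x0 Gx0; rewrite pc// -EFinM => -[] ccE.
  by rewrite mulrBr mulr1 -ccE subrr.
move=> /eqP; rewrite mulf_eq0 subr_eq0 => /orP[/eqP c_|/eqP c_].
  by left => x Gx; rewrite pc// c_.
by right => x Gx; rewrite pc// c_.
Qed.

(** * The law of large numbers *)

Notation path := (path_space E F).

Definition stationary_law : {measure set path -> \bar R} := mixture mu p.
Notation Q := stationary_law.

Lemma stationary_lawT : Q setT = 1.
Proof.
rewrite /stationary_law /= /mixture.
rewrite (eq_integral (cst 1)); last by move=> x _; rewrite prob_kernel.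
by rewrite integral_cst// mul1e; exact: probability_setT.
Qed.

(** Stationarity of the chain started from [mu]: invariance of [mu] and the
    Markov property at time 1. *)
Lemma stationary_shift A : measurable A -> Q (shift @^-1` A) = Q A.
Proof.
move=> mA; rewrite /stationary_law /= /mixture.
have msA : measurable (shift @^-1` A : set path).
  by rewrite -[X in measurable X]setTI; exact: measurable_shift.
rewrite -[RHS]invariant_integral//; last exact: measurable_kernel.
apply: (eq_integral_full mG muG) => //.
- exact: measurable_kernel.
- by move=> x; exact: integral_ge0.
- apply: measurable_fun_integral_kernel => //.
    by move=> B mB; exact: measurable_kernel.
  exact: measurable_kernel.
- by move=> x Gx; rewrite law_shift.
Qed.

Lemma stationary_integral_shift (f : path -> \bar R) : (forall w, 0 <= f w) ->
  measurable_fun setT f -> \int[Q]_w f (shift w) = \int[Q]_w f w.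
Proof.
move=> f0 mf; have msh := @measurable_shift _ _ E F.
have := ge0_integral_pushforward msh Q measurableT mf (fun w _ => f0 w).
rewrite preimage_setT /= => <-.
by apply: eq_measure_integral => A mA _; exact: stationary_shift.
Qed.

Lemma iter_shiftE k (w : path) j : iter k shift w j = w (k + j)%N.
Proof. by elim: k w j => //= k ih w j; rewrite /shift ih addnS. Qed.

Lemma measurable_iter_shift k : measurable_fun setT (iter k (@shift _ _ E F)).
Proof.
elim: k => [|k ih]; first exact: measurable_id.
exact: (measurableT_comp (@measurable_shift _ _ E F) ih).
Qed.

Lemma stationary_integral_iter k (f : path -> \bar R) :
  (forall w, 0 <= f w) -> measurable_fun setT f ->
  \int[Q]_w f (iter k shift w) = \int[Q]_w f w.
Proof.
move=> f0 mf; elim: k => // k ih.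
under eq_integral do rewrite iterSr.
rewrite (stationary_integral_shift (f := fun w => f (iter k shift w)))//.
by apply: measurableT_comp => //; exact: measurable_iter_shift.
Qed.

Lemma stationary_integral_first (f : E * F -> \bar R) :
  (forall z, 0 <= f z) -> measurable_fun setT f ->
  \int[Q]_w f (w 0%N) = \int[mu]_x \int[e x]_s f (x, s).
Proof.
move=> f0 mf; have mc := @measurable_coordinate _ _ E F 0%N.
have mfc : measurable_fun setT (fun w : path => f (w 0%N)) by exact: measurableT_comp.
rewrite (integral_mixture (k := p) (nu := mu))//.
apply: (eq_integral_full mG muG measurableT).
- by move=> x; exact: integral_ge0.
- apply: measurable_fun_integral_kernel => // B mB; exact: measurable_kernel.
- by move=> x; exact: integral_ge0.
- exact: measurable_fun_integral_finite_kernel.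
move=> x Gx; have mx : measurable_fun setT (fun s : F => (x, s)) := pair1_measurable x.
transitivity (\int[pushforward (p x) (fun w : path => w 0%N)]_z f z).
  by rewrite [RHS]ge0_integral_pushforward// preimage_setT.
transitivity (\int[pushforward (e x) (fun s => (x, s))]_z f z); last first.
  by rewrite [LHS]ge0_integral_pushforward// preimage_setT.
apply: eq_measure_integral => N mN _; rewrite /= /pushforward.
transitivity (e x (xsection N x)); last by rewrite xsectionE.
exact: law_first.
Qed.

Section one_observable.
Variable z : E * F -> R.
Hypothesis mz : measurable_fun setT z.
Hypothesis z0 : forall s, (0 <= z s)%R.

Definition path_sum n (w : path) : R := \sum_(0 <= k < n) z (w k).

Definition stationary_mean := \int[Q]_w (z (w 0%N))%:E.

Lemma measurable_path_sum n : measurable_fun setT (path_sum n).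
Proof.
apply: measurable_sum => k; apply: measurableT_comp => //.
exact: measurable_coordinate.
Qed.

Lemma path_sumS n w : path_sum n.+1 w = (z (w 0%N) + path_sum n (shift w))%R.
Proof. by rewrite /path_sum big_nat_recl. Qed.

(** The averages have limit superior greater than [a]. The positive slack, of
    the form 1 / (j + 1), is what makes the event invariant by the shift: part of
    it pays for the term gained or lost. *)
Definition exceeds (a : R) : set path := [set w | exists j : nat,
  forall m, exists2 n, (m <= n)%N & ((a + j.+1%:R^-1) * n%:R <= path_sum n w)%R].

Lemma measurable_exceeds a : measurable (exceeds a).
Proof.
rewrite (_ : exceeds a = \bigcup_j \bigcap_m \bigcup_(n in [set n | (m <= n)%N])
  [set w | ((a + j.+1%:R^-1) * n%:R <= path_sum n w)%R]); last first.
  apply/seteqP; split => w.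
    by move=> [j jw]; exists j => // m _; have [n] := jw m; exists n.
  by move=> [j _ jw]; exists j => m; have [n] := jw m I; exists n.
apply: bigcupT_measurable => j; apply: bigcapT_measurable => m.
apply: bigcup_measurable => n _; rewrite -[X in measurable X]setTI.
have := @measurable_fun_ler _ path R setT
  (cst ((a + j.+1%:R^-1) * n%:R)%R) (path_sum n) (measurable_cst _)
  (measurable_path_sum n).
exact.
Qed.

Lemma exceeds_shift a : shift @^-1` (exceeds a) = exceeds a.
Proof.
(* the slack is halved: the second half, times [n], outgrows the bounded error
   due to the shift *)
have half (j : nat) : (j.+1%:R^-1 = j.*2.+2%:R^-1 + j.*2.+2%:R^-1 :> R)%R.
  by rewrite -doubleS -muln2 natrM invfM -splitr.
apply/seteqP; split => w [j jw]; exists j.*2.+1 => m.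
  have [|N aN] := @archi_mull R (a + j.*2.+2%:R^-1) (j.*2.+2%:R^-1) => //.
  have [n] := jw (maxn m N); rewrite geq_max => /andP[mn Nn] nw.
  exists n.+1; first exact: leqW.
  have := aN n Nn; have := z0 (w 0%N); move: nw; rewrite path_sumS half -(natr1 n).
  move: (j.*2.+2%:R^-1 : R)%R (n%:R : R)%R => i r ? ? ?; nra.
have [|N aN] := @archi_mull R (z (w 0%N) - a - j.+1%:R^-1) (j.*2.+2%:R^-1) => //.
have [[|n]] := jw (maxn m N).+1; rewrite ?ltn0// ltnS geq_max => /andP[mn Nn].
move=> nw; exists n => //; have := aN n Nn; move: nw.
rewrite path_sumS half -(natr1 n).
move: (j.*2.+2%:R^-1 : R)%R (n%:R : R)%R => i r ? ?; nra.
Qed.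

Section maximal_inequality.
Variables (a : R) (M : nat).
Hypothesis a0 : (0 <= a)%R.

Definition exceeds_before : set path :=
  [set w | exists2 n, (0 < n <= M)%N & (a * n%:R <= path_sum n w)%R].

Lemma measurable_exceeds_before : measurable exceeds_before.
Proof.
rewrite (_ : exceeds_before = \bigcup_(n in [set n | (0 < n <= M)%N])
    [set w | (a * n%:R <= path_sum n w)%R]); last first.
  by apply/seteqP; split => w [n]; exists n.
apply: bigcup_measurable => n _; rewrite -[X in measurable X]setTI.
have := @measurable_fun_ler _ path R setT (cst (a * n%:R)%R) (path_sum n)
  (measurable_cst _) (measurable_path_sum n).
exact.
Qed.

(** The observable, raised by [a] at the paths without an early average as large
    as [a], from which no good block starts. *)
Definition corrected (w : path) : R :=
  (z (w 0%N) + a * \1_(~` exceeds_before) w)%R.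

Lemma corrected_ge0 w : (0 <= corrected w)%R.
Proof. by rewrite addr_ge0// mulr_ge0. Qed.

Lemma measurable_corrected : measurable_fun setT corrected.
Proof.
apply: measurable_funD.
  by apply: measurableT_comp => //; exact: measurable_coordinate.
apply: measurable_funM => //; apply: measurable_indic.
by apply: measurableC; exact: measurable_exceeds_before.
Qed.

(** The time axis is cut greedily into blocks: a block of length at most [M]
    with average at least [a] when there is one, and otherwise a single time,
    at which the correction contributes [a]. Only the last block may stick
    out, hence the loss [a * M]. *)
Lemma corrected_sum_ge N w :
  (a * N%:R <= \sum_(0 <= k < N) corrected (iter k shift w) + a * M%:R)%R.
Proof.
elim/ltn_ind: N w => N ih w.
have sum_ge0 n (w' : path) :
    (0 <= \sum_(0 <= k < n) corrected (iter k shift w'))%R.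
  by apply: sumr_ge0 => k _; exact: corrected_ge0.
have [NM|MN] := leqP N M.
  by rewrite ler_wpDl ?sum_ge0// ler_wpM2l// ler_nat.
have [[n /andP[n0 nM] nw]|nw] := pselect (exceeds_before w).
  have nN : (n <= N)%N by rewrite ltnW// (leq_ltn_trans nM).
  have sumE : (\sum_(0 <= k < N) corrected (iter k shift w) =
      \sum_(0 <= k < n) corrected (iter k shift w) +
      \sum_(0 <= k < N - n) corrected (iter k shift (iter n shift w)))%R.
    rewrite (big_cat_nat (leq0n n) nN) /=; congr (_ + _)%R.
    rewrite -{1}(add0n n) big_addn; apply: eq_bigr => k _.
    by rewrite iterD.
  have sum_n : (path_sum n w <= \sum_(0 <= k < n) corrected (iter k shift w))%R.
    apply: ler_sum => k _; rewrite /corrected iter_shiftE addn0.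
    by rewrite lerDl mulr_ge0.
  have := ih (N - n)%N _ (iter n shift w).
  rewrite ltn_subrL n0 (leq_ltn_trans _ MN)// => /(_ isT).
  rewrite sumE natrB// mulrBr; lra.
case: N MN ih => // N _ ih; rewrite big_nat_recl//=.
under eq_bigr do rewrite -iterS iterSr.
have := ih N (ltnSn N) (shift w).
rewrite {2}/corrected indicE mem_set// mulr1 -(natr1 N) mulrDr mulr1.
have := z0 (w 0%N); lra.
Qed.

(** The mean of the inequality [corrected_sum_ge], divided by [N]: as the chain
    is stationary, the loss [a * M] disappears when [N] tends to infinity. *)
Lemma stationary_mean_corrected : a%:E <=
  stationary_mean + a%:E * Q (~` exceeds_before).
Proof.
have mC := measurable_corrected.
have mB : measurable (~` exceeds_before).
  by apply: measurableC; exact: measurable_exceeds_before.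
have meanE : \int[Q]_w (corrected w)%:E =
    stationary_mean + a%:E * Q (~` exceeds_before).
  under eq_integral do rewrite EFinD EFinM.
  rewrite ge0_integralD//; last 4 first.
  - by move=> w _; rewrite lee_fin.
  - apply/measurable_EFinP; apply: measurableT_comp => //.
    exact: measurable_coordinate.
  - by move=> w _; rewrite -EFinM lee_fin mulr_ge0.
  - by apply: measurable_funeM; exact/measurable_EFinP.
  congr (_ + _); rewrite ge0_integralZl//.
  - by rewrite integral_indic// setIT.
  - exact/measurable_EFinP.
rewrite -meanE; case IE : (\int[Q]_w (corrected w)%:E) => [r||]; last 2 first.
- by rewrite leey.
- suff : 0 <= \int[Q]_w (corrected w)%:E by rewrite IE.
  by apply: integral_ge0 => w _; rewrite lee_fin corrected_ge0.
have sumE N : \int[Q]_w (\sum_(0 <= k < N) corrected (iter k shift w))%:E =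
    (r * N%:R)%:E.
  under eq_integral do rewrite -sumEFin.
  rewrite ge0_integral_sum//; last 2 first.
  - move=> k; apply/measurable_EFinP; apply: (measurableT_comp mC).
    exact: measurable_iter_shift.
  - by move=> k w _; rewrite lee_fin corrected_ge0.
  rewrite (eq_bigr (fun=> r%:E)); last first.
    move=> k _; rewrite (stationary_integral_iter _ (f := EFin \o corrected))//.
      by move=> w; rewrite lee_fin corrected_ge0.
    exact/measurable_EFinP.
  by rewrite sumEFin sumr_const_nat subn0 mulr_natr.
have Nmean N : (a * N%:R <= r * N%:R + a * M%:R)%R.
  have Qc (b : R) : \int[Q]_(w in setT) (cst b%:E w) = b%:E.
    by rewrite integral_cst// stationary_lawT mule1.
  rewrite -lee_fin EFinD -sumE -(Qc (a * N%:R)%R) -(Qc (a * M%:R)%R).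
  rewrite -ge0_integralD//; last 3 first.
  - by move=> w _; rewrite lee_fin sumr_ge0// => k _; exact: corrected_ge0.
  - apply/measurable_EFinP; apply: measurable_sum => k.
    by apply: (measurableT_comp mC); exact: measurable_iter_shift.
  - by move=> w _; rewrite lee_fin mulr_ge0.
  apply: ge0_le_integral => //.
  - by move=> w _; rewrite lee_fin mulr_ge0.
  - apply: emeasurable_funD => //; apply/measurable_EFinP.
    apply: measurable_sum => k.
    by apply: (measurableT_comp mC); exact: measurable_iter_shift.
  - by move=> w _; rewrite -EFinD lee_fin corrected_sum_ge.
rewrite lee_fin leNgt; apply/negP => ra.
have [|N aN] := @archi_mull R (a * M%:R + 1) (a - r); first by rewrite subr_gt0.
have := aN N (leqnn N); have := Nmean N; rewrite mulrBl; lra.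
Qed.

End maximal_inequality.

(** When the limit superior of the averages is almost surely greater than [a],
    almost every path has a good block, of some length: the correction tends to
    0 as the maximal length [M] grows. *)
Lemma exceeds_le_mean a : (0 <= a)%R ->
  (forall x, G x -> p x (exceeds a) = 1) -> a%:E <= stationary_mean.
Proof.
move=> a0 pa; have mB M := measurable_exceeds_before a M.
have mX := measurable_exceeds a.
have Qexc : Q (~` exceeds a) = 0.
  rewrite /stationary_law /= /mixture.
  transitivity (\int[mu]_(x in setT) (cst 0 x : \bar R)); last exact: integral0.
  apply: (eq_integral_full mG muG) => //.
    by apply: measurable_kernel; exact: measurableC.
  move=> x Gx /=; have h : p x (exceeds a) + p x (~` exceeds a) = 1.
    rewrite -measureU ?setUv//; [exact: prob_kernel|exact: measurableC|exact: setICr].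
  rewrite pa// in h.
  by rewrite -[LHS](addeK (x := 1))// [X in X - _]addeC h subee.
have cvQ : Q (~` exceeds_before a M) @[M --> \oo] --> (0 : \bar R).
  have <- : Q (\bigcap_M ~` exceeds_before a M) = 0.
    have mI : measurable (\bigcap_M ~` exceeds_before a M).
      by apply: bigcapT_measurable => M; exact: measurableC.
    apply: (@subset_measure0 _ _ _ Q _ (~` exceeds a)) => //.
      exact: measurableC.
    move=> w nw [j /(_ 1%N) [n n0 nle]]; apply: (nw n) => //.
    exists n; first by rewrite n0 leqnn.
    by rewrite (le_trans _ nle)// ler_wpM2r// lerDl.
  apply: nonincreasing_cvg_mu.
  - by rewrite (le_lt_trans _ (ltry 1))// -stationary_lawT le_measure ?inE//; exact: measurableC.
  - by move=> M; exact: measurableC.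
  - by apply: bigcapT_measurable => M; exact: measurableC.
  - move=> M N MN; apply/subsetPset/subsetC => w [n /andP[n0 nM] nw].
    by exists n => //; rewrite n0 (leq_trans nM).
have mean0 : 0 <= stationary_mean.
  by apply: integral_ge0 => w _; rewrite lee_fin.
have cvm : stationary_mean + a%:E * Q (~` exceeds_before a M) @[M --> \oo]
    --> stationary_mean + a%:E * 0.
  apply: cvgeD; [|exact: cvg_cst|exact: cvgeZl].
  by rewrite ge0_adde_def ?inE// mule0.
rewrite -[leRHS]adde0 -[X in _ + X](mule0 a%:E) -(cvg_lim _ cvm)//.
apply: lime_ge; first by apply/cvg_ex; exists (stationary_mean + a%:E * 0).
by apply: nearW => M; exact: stationary_mean_corrected.
Qed.

(** Otherwise, by the 0-1 law, the averages would have a limit superior greater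
    than some [b > stationary_mean] almost surely, against [exceeds_le_mean]. *)
Lemma path_sum_le a : stationary_mean < a%:E -> forall x, G x ->
  {ae p x, forall w, \forall n \near \oo, (path_sum n w <= a * n%:R)%R}.
Proof.
move=> ma x Gx.
have mean0 : 0 <= stationary_mean.
  by apply: integral_ge0 => w _; rewrite lee_fin.
have mfin : stationary_mean \is a fin_num.
  by rewrite ge0_fin_numE// (lt_trans ma)// ltry.
have ma' : (fine stationary_mean < a)%R by rewrite -lte_fin fineK.
have [b /andP[mb ba]] : exists b, (fine stationary_mean < b < a)%R.
  by exists ((fine stationary_mean + a) / 2)%R; rewrite !midf_lt.
have b0 : (0 <= b)%R by rewrite (le_trans _ (ltW mb))// fine_ge0.
have [p0|p1] := invariant_event_01 (measurable_exceeds b) (exceeds_shift b); last first.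
  have := exceeds_le_mean b0 p1.
  by rewrite -(fineK mfin) lee_fin leNgt mb.
exists (exceeds b); split; [exact: measurable_exceeds|exact: p0|].
move=> w /= nw; apply: contrapT => nexc; apply: nw.
have [j ja] := ltr_add_invr ba.
have [N Nw] : exists N, forall n, (N <= n)%N ->
    (path_sum n w < (b + j.+1%:R^-1) * n%:R)%R.
  apply: contrapT => h; apply: nexc; exists j => m.
  apply: contrapT => h'; apply: h; exists m => n mn.
  by rewrite ltNge; apply/negP => le_n; apply: h'; exists n.
exists N => // n /= Nn; apply: (le_trans (ltW (Nw n Nn))).
by rewrite ler_wpM2r// ltW.
Qed.

End one_observable.

(** The upper bound for the observable [b - z]. *)
Lemma path_sum_ge_bounded (z : E * F -> R) (b a : R) :
  measurable_fun setT z -> (forall s, (0 <= z s)%R) ->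
  (forall s, (z s <= b)%R) -> a%:E < stationary_mean z ->
  forall x, G x ->
  {ae p x, forall w, \forall n \near \oo, (a * n%:R <= path_sum z n w)%R}.
Proof.
move=> mz z0 zb az x Gx; pose z' s := (b - z s)%R.
have mz' : measurable_fun setT z' by exact: measurable_funB.
have z'0 s : (0 <= z' s)%R by rewrite subr_ge0.
have sumE n w : (path_sum z' n w = b * n%:R - path_sum z n w)%R.
  rewrite /path_sum /z' sumrB; congr (_ - _)%R.
  by rewrite sumr_const_nat subn0 mulr_natr.
have mcz (y : E * F -> R) : measurable_fun setT y ->
    measurable_fun setT (fun w : path => (y (w 0%N))%:E).
  move=> my; apply/measurable_EFinP; apply: measurableT_comp => //.
  exact: measurable_coordinate.
have meanD : stationary_mean z' + stationary_mean z = b%:E.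
  rewrite /stationary_mean -ge0_integralD//; last 4 first.
  - by move=> w _; rewrite lee_fin.
  - exact: mcz.
  - by move=> w _; rewrite lee_fin.
  - exact: mcz.
  transitivity (\int[Q]_(w in setT) (cst b%:E w)).
    by apply: eq_integral => w _; rewrite -EFinD subrK.
  by rewrite integral_cst// stationary_lawT mule1.
have m0 : 0 <= stationary_mean z by apply: integral_ge0 => w _; rewrite lee_fin.
have m'0 : 0 <= stationary_mean z' by apply: integral_ge0 => w _; rewrite lee_fin.
have z'a : stationary_mean z' < (b - a)%:E.
  move: meanD m0 m'0 az; case: (stationary_mean z) => [r||]//;
    case: (stationary_mean z') => [r'||]//=.
  by rewrite -EFinD => -[<-] _ _; rewrite !lte_fin; lra.
have := path_sum_le mz' z'0 z'a Gx.
apply: filterS => w; apply: filterS => n; rewrite sumE mulrBl; lra.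
Qed.

(** The observable is truncated at a level high enough for the mean to stay above
    [a]. *)
Lemma path_sum_ge (z : E * F -> R) (a : R) :
  measurable_fun setT z -> (forall s, (0 <= z s)%R) ->
  a%:E < stationary_mean z -> forall x, G x ->
  {ae p x, forall w, \forall n \near \oo, (a * n%:R <= path_sum z n w)%R}.
Proof.
move=> mz z0 az x Gx; pose zb (b : nat) s := Num.min (z s) b%:R.
have mzb b : measurable_fun setT (zb b) by exact: measurable_minr.
have zb0 b s : (0 <= zb b s)%R by rewrite le_min z0 ler0n.
have cvb : stationary_mean (zb b) @[b --> \oo] --> stationary_mean z.
  rewrite /stationary_mean.
  rewrite [X in _ --> X](_ : _ =
      \int[Q]_w limn (fun b => (zb b (w 0%N))%:E)); last first.
    apply: eq_integral => w _; apply/esym/cvg_lim => //.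
    apply: cvg_near_cst.
    exists (Num.bound (z (w 0%N))) => // b /= bz; rewrite /zb min_l//.
    by rewrite ltW// (lt_le_trans (archi_boundP (z0 _)))// ler_nat.
  apply: cvg_monotone_convergence => //.
  - move=> b; apply/measurable_EFinP; apply: measurableT_comp => //.
    exact: measurable_coordinate.
  - by move=> b w _; rewrite lee_fin.
  - move=> w _ b c bc; rewrite lee_fin /zb le_min ge_min lexx /=.
    by rewrite ge_min ler_nat bc orbT.
have [b ab] : exists b, a%:E < stationary_mean (zb b).
  apply: contrapT => h; move: az; rewrite ltNge => /negP; apply.
  rewrite -(cvg_lim _ cvb)//; apply: lime_le; first by apply/cvg_ex; eexists; exact: cvb.
  by apply: nearW => b; rewrite leNgt; apply/negP => ab; apply: h; exists b.
have zbb s : (zb b s <= b%:R)%R by rewrite ge_min lexx orbT.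
have := path_sum_ge_bounded (mzb b) (zb0 b) zbb ab Gx.
apply: filterS => w; apply: filterS => n h; apply: (le_trans h).
by apply: ler_sum => k _; rewrite ge_min lexx.
Qed.

(** The law of large numbers holds from every starting state of [G], not only
    from almost every one, because the 0-1 law does. *)
Theorem law_of_large_numbers (z : E * F -> R) (m : R) :
  measurable_fun setT z -> (forall s, (0 <= z s)%R) ->
  stationary_mean z = m%:E -> forall x, G x ->
  {ae p x, forall w, (path_sum z n w / n%:R @[n --> \oo] --> m)%R}.
Proof.
move=> mz z0 zm x Gx.
have up j : {ae p x, forall w,
    \forall n \near \oo, (path_sum z n w <= (m + j.+1%:R^-1) * n%:R)%R}.
  by apply: path_sum_le => //; rewrite zm lte_fin ltrDl.
have lo j : {ae p x, forall w,
    \forall n \near \oo, ((m - j.+1%:R^-1) * n%:R <= path_sum z n w)%R}.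
  by apply: path_sum_ge => //; rewrite zm lte_fin ltrBlDr ltrDl.
move: (ae_foralln up) (ae_foralln lo); apply: filterS2 => w upw low; apply/cvgrPdist_le => eps eps0.
have [j] := ltr_add_invr eps0; rewrite add0r => je.
near=> n.
have n0 : (0 < n%:R :> R)%R by rewrite ltr0n; near: n; exact: nbhs_infty_gt.
have upn : (path_sum z n w <= (m + j.+1%:R^-1) * n%:R)%R by near: n; exact: upw.
have lown : ((m - j.+1%:R^-1) * n%:R <= path_sum z n w)%R by near: n; exact: low.
rewrite -ler_pdivrMr// in upn; rewrite -ler_pdivlMr// in lown.
move: (path_sum z n w / n%:R)%R upn lown => S; move: (j.+1%:R^-1 : R)%R je => i ie upn lown.
by rewrite ler_norml; apply/andP; split; lra.
Unshelve. all: by end_near. Qed.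

End ergodic_chain.

(** * The support of a probability on a Polish space *)

Section polish_support.
Context (R : realType) (E : ptopologicalType).
Hypothesis hE : polish R E.
Variable pi : probability (borel E) R.

Lemma open_borel (U : set (borel E)) : open (U : set E) -> measurable U.
Proof. by move=> oU; exact: sub_sigma_algebra. Qed.

Lemma polish_measurable_set1 (x : borel E) : measurable [set x].
Proof.
have [_ [M [h [k [hk kh ch ck _]]]]] := hE.
rewrite -(setCK [set x]); apply: measurableC; apply: open_borel.
have -> : (~` [set x] : set E) = h @^-1` (~` [set h x]).
  apply/seteqP; split => y /= nyx; apply: contra_not nyx; last by move=> ->.
  exact: (can_inj hk).
apply: open_comp => [y _|]; first exact: ch.
apply: closed_openC; apply: accessible_closed_set1.
exact/hausdorff_accessible/metric_hausdorff.
Qed.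

Lemma measurable_supp : measurable (supp pi : set (borel E)).
Proof.
rewrite -(setCK (supp pi)); apply: measurableC; apply: open_borel.
rewrite openE => x; rewrite /supp /= => /existsNP[U /not_implyP[oU /not_implyP[Ux piU]]].
rewrite /interior; apply: (filterS _ (open_nbhs_nbhs (conj oU Ux))).
by move=> y Uy; apply/existsNP; exists U; apply/not_implyP; split => //; exact/not_implyP.
Qed.

(** The complement of the support is a union of null sets taken from a
    countable family of balls, with centres in a dense sequence. *)
Lemma polish_supp_full : pi (~` supp pi) = 0.
Proof.
have [[D cD dD] [M [h [k [hk kh ch ck _]]]]] := hE.
have [D0|[d]] := pfcard_geP cD.
  by have [y []] := dD setT (ex_intro _ point I) openT; rewrite D0.
pose O (q : nat * nat) : set (borel E) :=
  interior (h @^-1` ball (h (d q.1)) (2 * q.2.+1%:R^-1)%R).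
have mO q : measurable (O q) by apply: open_borel; exact: open_interior.
pose N (j : nat) : set (borel E) :=
  if unpickle j is Some q then (if `[< pi (O q) = 0 >] then O q else set0) else set0.
have mN j : measurable (N j).
  by rewrite /N; case: unpickle => // q; case: asboolP.
have piN j : pi (N j) = 0.
  by rewrite /N; case: unpickle => [q|]; rewrite ?measure0//; case: asboolP.
apply: (@subset_measure0 _ _ _ pi _ (\bigcup_j N j)).
- by apply: measurableC; exact: measurable_supp.
- exact: bigcupT_measurable.
- move=> x; rewrite /supp /= => /existsNP[U /not_implyP[oU /not_implyP[Ux /negP piU]]].
  have piU0 : pi U = 0.
    by apply/eqP; rewrite eq_le measure_ge0 andbT leNgt.
  have : nbhs (h x) (k @^-1` U).
    apply: ck; rewrite hk; exact: open_nbhs_nbhs.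
  move=> /nbhs_ballP[_/posnumP[eps] epsU].
  (* a ball of radius [2 * r] with centre within [r] of [x] contains [x] and
     lies within [3 * r] of [x], hence the third of [eps] *)
  have e0 : (0 < eps%:num / 3)%R by [].
  have [n] := ltr_add_invr e0; rewrite add0r => neps.
  pose r : R := (n.+1%:R^-1)%R.
  have r0 : (0 < r)%R by rewrite /r invr_gt0.
  have nx : nbhs x (h @^-1` ball (h x) r) by apply: ch; exact: nbhsx_ballx.
  have [] := dD (interior (h @^-1` ball (h x) r)).
  - by exists x.
  - exact: open_interior.
  move=> y [/interior_subset /= hxy Dy].
  have [j _ dj] : (d @` setT) y by have := surj Dy.
  have Ox : O (j, n) x.
    rewrite /O /= dj; apply: filterS nx => u /= hxu.
    rewrite mulr_natl mulr2n; apply: ball_triangle hxu; exact: ball_sym.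
  have OU : O (j, n) `<=` U.
    move=> u /interior_subset /=; rewrite dj => hyu.
    rewrite -(hk u); apply: epsU; apply: (@le_ball _ _ _ (r + 2 * r)%R).
      by move: neps; rewrite -/r ltr_pdivlMr//; lra.
    exact: ball_triangle hxy hyu.
  exists (pickle (j, n)) => //; rewrite /N pickleK; case: asboolP => // nO.
  case: nO; apply: (@subset_measure0 _ _ _ pi _ U) => //; exact: open_borel.
- apply/eqP; rewrite eq_le measure_ge0 andbT.
  apply: (@le_trans _ _ (\sum_(0 <= j <oo) pi (N j))).
    by apply: measure_sigma_subadditive => //; exact: bigcupT_measurable.
  by rewrite eseries0.
Qed.

End polish_support.

(** * Jump rates and detailed balance *)

Section balanced_rates.
Context (R : realType) (E : ptopologicalType).
Variables (pi : probability (borel E) R)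
  (gamma : R.-pker (borel E) ~> (borel E))
  (t : borel E * borel E -> R) (g : R -> R).
Hypothesis ht : density_ratio pi gamma t.
Hypothesis hg : balancing_function g.
Hypothesis g_mono : forall r s : R, (0 <= r)%R -> (r <= s)%R -> (g r <= g s)%R.

Let mt : measurable_fun setT t. Proof. by case: ht. Qed.
Let t0 z : (0 <= t z)%R. Proof. by case: ht. Qed.

Lemma balanced_ge0 z : (0 <= g (t z))%R.
Proof.
have [_ _ g0 gpos _] := hg; have := t0 z.
by rewrite le_eqVlt => /predU1P[<-|/gpos/ltW//]; rewrite g0.
Qed.

Lemma measurable_balanced : measurable_fun setT (g \o t).
Proof.
have [mgc _ _ _ _] := hg.
apply: (@measurable_comp _ _ _ _ _ _ (`[0%R, +oo[%classic : set R) g setT t) => //.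
by move=> _ [z _ <-] /=; rewrite in_itv/= t0.
Qed.

(** Below 1, [g] is at most [g 1 = 1] by monotonicity; above 1, the balancing
    identity reduces [g s] to [s] times a value below 1. *)
Lemma balancing_le s : (0 <= s)%R -> (g s <= 1 + s)%R.
Proof.
have [_ g1 _ _ gs] := hg => s0; have [s1|s1] := leP s 1%R.
  by rewrite (le_trans (g_mono s0 s1))// g1 lerDl.
have sp : (0 < s)%R by exact: lt_trans s1.
rewrite gs// (le_trans (y := s * g 1)%R)//.
  by rewrite ler_wpM2l// g_mono ?invr_ge0// invf_le1// ltW.
by rewrite g1 mulr1 lerDr.
Qed.

Let swap (z : borel E * borel E) := (z.2, z.1).

Let mswap : measurable_fun setT swap.
Proof. by apply: measurable_fun_pair. Qed.

Let balanced_swap z : g (t z) = (t z * g (t (swap z)))%R.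
Proof.
have [_ _ _ [S [_ _ tS tnS]]] := ht; have [_ _ g0 _ gs] := hg.
have [Sz|/tnS tz] := pselect (S z); last by rewrite tz g0 mul0r.
by case: z Sz => x y /tS [txy tyx]; rewrite gs// /swap/= tyx.
Qed.

(** Detailed balance: the jump intensities g(t(x, y)) pi(dx) gamma(x, dy) are
    symmetric, because g(t) = t g(1 / t) and t exchanges pi(dx) gamma(x, dy)
    with its reversal. *)
Lemma detailed_balance f : (forall z, 0 <= f z) -> measurable_fun setT f ->
  \int[otimes pi gamma]_z ((g (t z))%:E * f (z.2, z.1)) =
  \int[otimes pi gamma]_z ((g (t z))%:E * f z).
Proof.
move=> f0 mf; have [_ _ tE _] := ht.
have mgt := measurable_balanced.
pose F z := (g (t z))%:E * f z.
have F0 z : 0 <= F z by rewrite mule_ge0// lee_fin balanced_ge0.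
have mF : measurable_fun setT F.
  apply: (@emeasurable_funM _ _ _ _ (EFin \o (g \o t))) => //.
  exact/measurable_EFinP.
have mFs : measurable_fun setT (F \o swap) by exact: measurableT_comp.
transitivity (\int[otimes pi gamma]_z ((t z)%:E * (F \o swap) z)).
  apply: eq_integral => z _; rewrite balanced_swap EFinM -muleA.
  by rewrite /F /swap/=.
rewrite -(integral_density t0 mt (mu := pushforward (otimes pi gamma) swap))//.
  rewrite ge0_integral_pushforward//=.
  by rewrite preimage_setT; apply: eq_integral => -[x y] _.
- by move=> A mA; rewrite tE.
- by move=> z; exact: F0.
Qed.

Notation rate := (jump_rate gamma t g).

Lemma jump_rate_ge0 x : 0 <= rate x.
Proof. by apply: integral_ge0 => y _; rewrite lee_fin balanced_ge0. Qed.

Lemma measurable_jump_rate : measurable_fun setT rate.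
Proof.
apply: (measurable_fun_integral_finite_kernel (fun z => (g (t z))%:E)) => //.
  by move=> z; rewrite lee_fin balanced_ge0.
by apply/measurable_EFinP; exact: measurable_balanced.
Qed.

(** Detailed balance for the indicator of [A]: the flow out of [A] equals the flow
    into [A]. *)
Lemma integral_jump_rate_restrict A : measurable A ->
  \int[pi]_(x in A) rate x =
  \int[pi]_x \int[gamma x]_(y in A) (g (t (x, y)))%:E.
Proof.
move=> mA; have mgt := measurable_balanced.
pose f (z : borel E * borel E) : \bar R := (\1_A z.2)%:E.
have mf : measurable_fun setT f.
  by apply/measurable_EFinP; apply: measurableT_comp.
have mfs : measurable_fun setT (fun z => f (swap z)) by exact: measurableT_comp.
have f0 z : 0 <= f z by rewrite lee_fin.
have mG h : measurable_fun setT h -> measurable_fun setT (fun z => (g (t z))%:E * h z).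
  move=> mh; apply: (@emeasurable_funM _ _ _ _ (EFin \o (g \o t))) => //.
  exact/measurable_EFinP.
have G0 h z : (forall z, 0 <= h z) -> 0 <= (g (t z))%:E * h z.
  by move=> h0; rewrite mule_ge0// lee_fin balanced_ge0.
transitivity (\int[otimes pi gamma]_z ((g (t z))%:E * f (z.2, z.1))).
  rewrite integral_otimes//; last 2 first.
  - by move=> z; exact: (G0 (fun z => f (swap z))).
  - exact: (mG (fun z => f (swap z))).
  rewrite integral_mkcond; apply: eq_integral => x _.
  rewrite /f /= ge0_integralZr//.
  - rewrite patchE indicE; case: ifP => _; first by rewrite mule1.
    by rewrite mule0.
  - apply/measurable_EFinP; exact: (measurableT_comp mgt (pair1_measurable x)).
  - by move=> y _; rewrite lee_fin balanced_ge0.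
rewrite detailed_balance// integral_otimes//; last 2 first.
- by move=> z; exact: (G0 f).
- exact: mG.
apply: eq_integral => x _; rewrite [RHS]integral_mkcond.
apply: eq_integral => y _; rewrite /f /= patchE indicE.
by case: ifP => _; rewrite ?mule1 ?mule0.
Qed.

(** The function [1 + t] dominates [g t] and has mean 2, since [t] is a
    density between two probabilities. *)
Lemma integral_jump_rate_lty : \int[pi]_x rate x < +oo.
Proof.
have [_ _ tE _] := ht; have mgt := measurable_balanced.
rewrite -(integral_otimes pi gamma (f := fun z => (g (t z))%:E)); last 2 first.
- by move=> z; rewrite lee_fin balanced_ge0.
- exact/measurable_EFinP.
have oT : (otimes pi gamma : {measure set (borel E * borel E) -> \bar R}) setT = 1.
  rewrite /= /otimes (eq_integral (cst 1)); last first.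
    by move=> x _; rewrite xsectionE preimage_setT prob_kernel.
  by rewrite integral_cst// mul1e; exact: probability_setT.
apply: (@le_lt_trans _ _ (\int[otimes pi gamma]_z (1 + (t z)%:E))).
  apply: ge0_le_integral => //.
  - by move=> z _; rewrite lee_fin balanced_ge0.
  - exact/measurable_EFinP.
  - by apply: emeasurable_funD => //; exact/measurable_EFinP.
  - by move=> z _; rewrite -EFinD lee_fin balancing_le.
rewrite ge0_integralD//; last 2 first.
- by move=> z _; rewrite lee_fin.
- exact/measurable_EFinP.
rewrite integral_cst// tE// /pushforward.
by rewrite (_ : swap @^-1` setT = setT)// oT [X in _ + X]oT mul1e -EFinD ltry.
Qed.

End balanced_rates.

(** * The embedded kernel and the exponential kernel *)

Section jump_kernel.
Context (R : realType) (E : ptopologicalType).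
Variables (pi : probability (borel E) R)
  (gamma : R.-pker (borel E) ~> (borel E))
  (t : borel E * borel E -> R) (g : R -> R).
Hypothesis ht : density_ratio pi gamma t.
Hypothesis hg : balancing_function g.

Notation rate := (jump_rate gamma t g).

Let scaled x y := (g (t (x, y)) / fine (rate x))%R.

Let scaled_ge0 x y : (0 <= scaled x y)%R.
Proof.
by rewrite divr_ge0 ?(balanced_ge0 ht hg)// fine_ge0// (jump_rate_ge0 ht hg).
Qed.

Let mrate : measurable_fun setT (fun x => fine (rate x)).
Proof. by apply: measurableT_comp => //; exact: (measurable_jump_rate ht hg). Qed.

Let mscaled2 : measurable_fun setT (fun z : borel E * borel E => scaled z.1 z.2).
Proof.
apply: measurable_funM.
  rewrite (_ : (fun z => _) = g \o t); last by apply/funext => -[].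
  exact: measurable_balanced ht hg.
(* the inverse of a nonnegative number as a power, which is measurable *)
rewrite (_ : (fun z => _) =
    (@powR R ^~ (-1)%R) \o (fun z : borel E * borel E => fine (rate z.1))).
  apply: measurableT_comp; first exact: measurable_powR.
  exact: (measurableT_comp mrate).
apply/funext => z /=; rewrite powR_inv1// fine_ge0//.
exact: (jump_rate_ge0 ht hg).
Qed.

Let mscaled x : measurable_fun setT (scaled x).
Proof. exact: (measurableT_comp mscaled2 (pair1_measurable x)). Qed.

(** The embedded kernel as a probability kernel, whose values are measures by
    construction. *)
Definition jump_kernel (x : borel E) : {measure set (borel E) -> \bar R} :=
  if (rate x == 0) || (rate x == +oo) then (\d_x : {measure set _ -> \bar R})
  else (density (gamma x) (scaled_ge0 x) (mscaled x) : {measure set _ -> \bar R}).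
Notation K := jump_kernel.

Lemma jump_kernelE x A : K x A = embedded_kernel gamma t g x A.
Proof. by rewrite /jump_kernel /embedded_kernel; case: ifP. Qed.

Let measurable_jump_kernel A : measurable A ->
  measurable_fun setT (fun x => K x A).
Proof.
move=> mA; under eq_fun do rewrite jump_kernelE /embedded_kernel.
have mr := measurable_jump_rate ht hg.
apply: measurable_fun_ifT => //=.
- by apply: measurable_or; apply: measurable_fun_eqe.
- exact/measurable_EFinP.
pose k (z : borel E * borel E) := (\1_A z.2 * scaled z.1 z.2)%:E.
rewrite (_ : (fun x => _) = fun x => \int[gamma x]_y k (x, y)).
  apply: measurable_fun_integral_finite_kernel.
    by move=> z; rewrite lee_fin mulr_ge0.
  apply/measurable_EFinP; apply: measurable_funM => //.
  by apply: measurableT_comp.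
apply/funext => x; rewrite [LHS]integral_mkcond; apply: eq_integral => y _.
by rewrite patchE /k /= indicE; case: ifP => _; rewrite ?mul1r ?mul0r.
Qed.

HB.instance Definition _ := isKernel.Build _ _ _ _ R K measurable_jump_kernel.

Let jump_kernel_prob x : K x setT = 1.
Proof.
rewrite jump_kernelE /embedded_kernel.
have [|] := boolP ((rate x == 0) || (rate x == +oo)) => [_|].
  by rewrite diracT.
rewrite negb_or => /andP[r0 roo].
have rfin : rate x \is a fin_num.
  by rewrite ge0_fin_numE ?(jump_rate_ge0 ht hg)// lt_neqAle roo leey.
rewrite /=; under eq_integral do rewrite EFinM.
rewrite ge0_integralZr//; last 3 first.
- apply/measurable_EFinP.
  exact: (measurableT_comp (measurable_balanced ht hg) (pair1_measurable x)).
- by move=> y _; rewrite lee_fin (balanced_ge0 ht hg).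
- by rewrite lee_fin invr_ge0 fine_ge0// (jump_rate_ge0 ht hg).
rewrite -[X in X * _]/(rate x) -{1}(fineK rfin) -EFinM divff//.
by rewrite fine_eq0.
Qed.

HB.instance Definition _ := Kernel_isProbability.Build _ _ _ _ R K jump_kernel_prob.

End jump_kernel.

Section exponential_mean.
Context (R : realType).
Local Notation leb := (@lebesgue_measure R).
Variable r : R.
Hypothesis r0 : (0 < r)%R.

(** The primitive of [r * s * expR (- (r * s))] that vanishes at infinity. *)
Let antider (s : R) : R := (- ((s + r^-1) * expR (- (r * s))))%R.

Let antider_is_derive (s : R) : is_derive s (1 : R)%R antider (r * s * expR (- (r * s)))%R.
Proof.
apply: is_derive_eq; rewrite /GRing.scale/=.
have rn0 : r != 0%R by rewrite gt_eqF.
by field.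
Qed.

Let antider_cvg : antider s @[s --> +oo%R] --> (0 : R)%R.
Proof.
rewrite -[X in _ --> X]oppr0; apply: cvgN.
have le_s s : (1 <= s)%R ->
    (0 <= (s + r^-1) * expR (- (r * s)) <= 2 * (1 + r^-1) / r ^+ 2 * s^-1)%R.
  move=> s1; have s0 : (0 < s)%R by exact: lt_le_trans s1.
  have sr : (0 <= s + r^-1)%R by rewrite addr_ge0 ?invr_ge0// ltW.
  rewrite mulr_ge0 ?expR_ge0//= expRN.
  have rs0 : (0 <= r * s)%R by rewrite mulr_ge0// ltW.
  have rs2 : ((r * s) ^+ 2 / 2 <= expR (r * s))%R.
    by rewrite (le_trans _ (expR_ge1Dxn 1 rs0))// lerDr.
  have rs2p : (0 < (r * s) ^+ 2 / 2)%R by rewrite divr_gt0// exprn_gt0// mulr_gt0.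
  apply: (@le_trans _ _ ((s + r^-1) * ((r * s) ^+ 2 / 2)^-1)%R).
    by rewrite ler_wpM2l// lef_pV2// posrE expR_gt0.
  have -> : (((r * s) ^+ 2 / 2)^-1 = 2 / r ^+ 2 * s ^- 2)%R.
    by rewrite invfM invrK exprMn invfM mulrC mulrA.
  have -> : (2 * (1 + r^-1) / r ^+ 2 * s^-1 = (s * (1 + r^-1)) * (2 / r ^+ 2 * s ^- 2))%R.
    have sn0 : s != 0%R by rewrite gt_eqF.
    have rn0 : r != 0%R by rewrite gt_eqF.
    by field; rewrite ?rn0 ?sn0.
  rewrite ler_wpM2r//; first by rewrite !mulr_ge0// invr_ge0 exprn_ge0// ltW.
  by rewrite mulrDr mulr1 lerD2l ler_peMl// invr_ge0 ltW.
pose c : R := (2 * (1 + r^-1) / r ^+ 2)%R.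
apply: (@squeeze_cvgr R _ _ R (fun=> 0%R) (fun s => c * s^-1)%R).
- by near=> s; apply: le_s; near: s; exact: nbhs_pinfty_ge.
- exact: cvg_cst.
- rewrite -[X in _ --> X](mulr0 c); apply: cvgMl_tmp.
  apply/(@gtr0_cvgV0 R R _ _ id); last exact: cvg_id.
  by near=> s; near: s; exact: nbhs_pinfty_gt.
Unshelve. all: by end_near. Qed.

Lemma exponential_mean :
  \int[leb]_(s in `[0%R, +oo[) (r * s * expR (- (r * s)))%:E = (r^-1)%:E.
Proof.
rewrite (@ge0_continuous_FTC2y _ _ antider _ 0%R)//.
- by rewrite -EFinB sub0r /antider mulr0 oppr0 expR0 add0r mulr1 opprK.
- by move=> s s0; rewrite !mulr_ge0 ?expR_ge0// ltW.
- apply: continuous_subspaceT => s; apply: differentiable_continuous.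
  by apply/derivable1_diffP; exact: ex_derive.
- apply: cvg_at_right_filter; apply: differentiable_continuous.
  by apply/derivable1_diffP; exact: ex_derive.
- by move=> s _; rewrite derive1E; exact: derive_val.
Qed.

End exponential_mean.

Section exponential_kernel.
Context (R : realType) d (X : measurableType d) (rate : X -> R).
Hypothesis rate0 : forall x, (0 <= rate x)%R.
Hypothesis mrate : measurable_fun setT rate.
Local Notation leb := (@lebesgue_measure R).

Let pdf_ge0 x s : (0 <= exponential_pdf (rate x) s)%R.
Proof. exact: exponential_pdf_ge0. Qed.

Lemma measurable_exponential_pdf2 : measurable_fun setT
  (fun z : X * measurableTypeR R => exponential_pdf (rate z.1) z.2).
Proof.
rewrite (_ : (fun z => _) = fun z : X * measurableTypeR R => (\1_`[0%R, +oo[%classic z.2 *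
    (rate z.1 * expR (- rate z.1 * z.2)))%R); last first.
  apply/funext => z; rewrite /exponential_pdf patchE indicE.
  by case: ifP => _; rewrite ?mul1r ?mul0r.
have m1 : measurable_fun setT (fun z : X * measurableTypeR R => rate z.1) by exact: measurableT_comp.
apply: measurable_funM; first exact: measurableT_comp.
apply: measurable_funM => //; apply: measurableT_comp => //.
apply: measurable_funM => //; exact: measurableT_comp.
Qed.

Let mpdf x : measurable_fun (setT : set (measurableTypeR R)) (exponential_pdf (rate x)).
Proof. exact: measurable_exponential_pdf. Qed.

(** At rate 0, where there is no exponential density, the value is an arbitrary
    probability on nonnegative numbers; it keeps the kernel a probability at
    every point. *)
Definition exp_kernel of measurable_fun setT rate :=
  fun x : X =>
  if rate x == 0%R then (\d_(0%R : measurableTypeR R) : {measure set (measurableTypeR R) -> \bar R})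
  else (density leb (pdf_ge0 x) (mpdf x) : {measure set (measurableTypeR R) -> \bar R}).
Notation ek := (exp_kernel mrate).

Lemma exp_kernelE x A : rate x != 0%R ->
  ek x A = exponential_prob (rate x) A.
Proof. by rewrite /exp_kernel => /negbTE ->. Qed.

Let measurable_exp_kernel A : measurable A ->
  measurable_fun setT (fun x => ek x A).
Proof.
move=> mA; rewrite (_ : (fun x => _) = fun x => if rate x == 0%R then \d_(0%R : measurableTypeR R) A
    else exponential_prob (rate x) A); last first.
  by apply/funext => x; rewrite /exp_kernel; case: ifP.
apply: measurable_fun_ifT => //=; first exact: measurable_fun_eqr.
pose k (z : X * measurableTypeR R) := (\1_A z.2 * exponential_pdf (rate z.1) z.2)%:E.
rewrite (_ : (fun x => _) = fun x => \int[leb]_s k (x, s)).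
  apply: (measurable_fun_fubini_tonelli_F k).
    apply/measurable_EFinP; apply: measurable_funM => //.
      by apply: measurableT_comp.
    exact: measurable_exponential_pdf2.
  by move=> z; rewrite lee_fin mulr_ge0.
apply/funext => x; rewrite /exponential_prob [LHS]integral_mkcond.
apply: eq_integral => s _; rewrite patchE /k /= indicE.
by case: ifP => _; rewrite ?mul1r ?mul0r.
Qed.

HB.instance Definition _ := isKernel.Build _ _ _ _ R ek measurable_exp_kernel.

Let exp_kernel_prob x : ek x setT = 1.
Proof.
have [/eqP r0|r0] := eqVneq (rate x) 0%R.
  by rewrite /exp_kernel ifT//= diracT.
rewrite exp_kernelE// /exponential_prob integral_exponential_pdf//.
by rewrite lt_neqAle eq_sym r0 rate0.
Qed.

HB.instance Definition _ := Kernel_isProbability.Build _ _ _ _ R ek exp_kernel_prob.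

Lemma exp_kernel_neg x : ek x [set s | (s < 0)%R] = 0.
Proof.
have [/eqP r0|r0] := eqVneq (rate x) 0%R.
  by rewrite /exp_kernel ifT//= diracE memNset//= ltxx.
rewrite exp_kernelE//; apply: integral0_eq => s /= s0.
by rewrite lt0_exponential_pdf.
Qed.

(** The positive part, which almost every holding time equals, makes the
    integrand nonnegative everywhere. *)
Lemma exp_kernel_mean x : (0 < rate x)%R ->
  \int[ek x]_s (Num.max s 0%R)%:E = ((rate x)^-1)%:E.
Proof.
move=> r0; rewrite (integral_density (pdf_ge0 x) (mpdf x) (nu := leb)); last 3 first.
- by move=> A mA; rewrite exp_kernelE// gt_eqF.
- by move=> s; rewrite lee_fin le_max lexx orbT.
- by apply/measurable_EFinP; exact: measurable_maxr.
rewrite -exponential_mean// [RHS]integral_mkcond; apply: eq_integral => s _.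
rewrite /exponential_pdf !patchE; case: ifPn => [|].
  rewrite inE /= in_itv/= andbT => s0; rewrite max_l// -EFinM mulNr.
  by congr EFin; ring.
by rewrite mul0e.
Qed.

End exponential_kernel.

(** * Integrals along a Markov chain *)

Section markov_chain_law.
Context (R : realType) (dO : measure_display) (Omega : measurableType dO)
  (E : ptopologicalType).
Variables (P : probability Omega R) (X : nat -> {mfun Omega >-> borel E}).
Variables (K : R.-pker (borel E) ~> (borel E)) (x : borel E).
Hypothesis chain : markov_chain P X (fun y A => K y A) x.

Let generators n : set (set Omega) :=
  \bigcup_(i in `I_n.+1) preimage_set_system setT (X i) measurable.

(** The space [Omega] with the sigma-algebra of the first [n.+1] states. *)
Let history n := g_sigma_algebraType (generators n).

Let measurable_history n (C : set Omega) :
  measurable (C : set (history n)) -> measurable C.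
Proof.
apply: smallest_sub; first exact: sigma_algebra_measurable.
by move=> _ [i _ [B mB <-]]; exact: measurable_funP.
Qed.

Let measurable_to_history n :
  measurable_fun setT (fun w : Omega => (w : history n)).
Proof. by move=> _ C mC; rewrite setTI; exact: (@measurable_history n). Qed.

Let measurable_state n i : (i <= n)%N ->
  measurable_fun setT (X i : history n -> borel E).
Proof.
by move=> ilen _ B mB; apply: sub_sigma_algebra; exists i => //; exists B.
Qed.

(** The definition of a Markov chain says that, on events of the past, the
    measure restricted to [X n.+1 \in B] has density [K (X n) B]; integrals of
    functions of the past against both measures agree. *)
Let markov_weight_set n (f : history n -> R) B :
  (forall w, (0 <= f w)%R) -> measurable_fun setT f -> measurable B ->
  \int[P]_w ((\1_B (X n.+1 w) * f w)%:E) = \int[P]_w (K (X n w) B * (f w)%:E).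
Proof.
move=> f0 mf mB; have [_ chainS] := chain.
have mid := @measurable_to_history n.
have mXB : measurable (X n.+1 @^-1` B).
  by rewrite -[X in measurable X]setTI; exact: measurable_funP.
have mfE : measurable_fun setT (EFin \o f) by exact/measurable_EFinP.
pose k (w : history n) := fine (K (X n w) B).
have k0 w : (0 <= k w)%R by rewrite fine_ge0.
have kE w : (k w)%:E = K (X n w) B by rewrite /k fineK// pker_fin_num.
have mk : measurable_fun setT k.
  apply: measurableT_comp => //.
  exact: (measurableT_comp (measurable_kernel K _ mB) (measurable_state (leqnn n))).
have i0 (w : Omega) : (0 <= (\1_(X n.+1 @^-1` B) : Omega -> R) w)%R by rewrite indicE.
have mi : measurable_fun setT (\1_(X n.+1 @^-1` B) : Omega -> R) by exact: measurable_indic.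
transitivity (\int[pushforward (mrestr P mXB) (fun w => (w : history n))]_w (f w)%:E).
  rewrite ge0_integral_pushforward//; last by move=> w _; rewrite lee_fin.
  rewrite preimage_setT (integral_density i0 mi (nu := P))//=.
  - move=> A mA; rewrite /mrestr integral_indic//.
    by rewrite setIC.
  - by apply/measurable_EFinP; exact: (measurableT_comp mf mid).
rewrite (integral_density k0 mk (nu := pushforward P (fun w => (w : history n))))//.
  rewrite ge0_integral_pushforward//=.
  - by rewrite preimage_setT; apply: eq_integral => w _; rewrite kE.
  - by apply: emeasurable_funM => //; exact/measurable_EFinP.
  - by move=> w _; rewrite mule_ge0// lee_fin.
move=> C mC; rewrite ge0_integral_pushforward//.
- transitivity (P (C `&` X n.+1 @^-1` B)) => //; rewrite chainS//.
  by apply: eq_integral => w _; rewrite /= kE.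
- by apply/measurable_EFinP; exact: measurable_funTS.
- by move=> w _; rewrite lee_fin.
Qed.

(** Seen from [X n.+1], the measure weighted by [f] is the mixture of [K] along
    its image by [X n]. *)
Let markov_weight n (f : history n -> R) (v : borel E -> \bar R) :
  (forall w, (0 <= f w)%R) -> measurable_fun setT f ->
  (forall y, 0 <= v y) -> measurable_fun setT v ->
  \int[P]_w ((f w)%:E * v (X n.+1 w)) =
  \int[P]_w ((f w)%:E * \int[K (X n w)]_y v y).
Proof.
move=> f0 mf v0 mv.
have mfO : measurable_fun setT (f : Omega -> R).
  exact: (measurableT_comp mf (@measurable_to_history n)).
pose rho : {measure set Omega -> \bar R} := density P f0 mfO.
have rhoE h : (forall w, 0 <= h w) -> measurable_fun setT h ->
    \int[rho]_w h w = \int[P]_w ((f w)%:E * h w).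
  by move=> h0 mh; rewrite (integral_density f0 mfO (nu := P)).
have mX i : measurable_fun setT (X i) by exact: measurable_funP.
have push i h : (forall y, 0 <= h y) -> measurable_fun setT h ->
    \int[pushforward rho (X i)]_y h y = \int[P]_w ((f w)%:E * h (X i w)).
  move=> h0 mh; rewrite ge0_integral_pushforward// preimage_setT rhoE//.
    by move=> w; exact: h0.
  exact: (measurableT_comp mh (mX i)).
rewrite -(push n.+1)//.
rewrite (integral_mixture (k := K) (nu := pushforward rho (X n)))//.
  rewrite push//; first by move=> y; exact: integral_ge0.
  apply: measurable_fun_integral_kernel => // A mA; exact: measurable_kernel.
move=> B mB; rewrite push//; last exact: measurable_kernel.
transitivity (\int[P]_w ((\1_B (X n.+1 w) * f w)%:E)); last first.
  by rewrite (markov_weight_set f0 mf mB); apply: eq_integral => w _; rewrite muleC.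
have mXB : measurable (X n.+1 @^-1` B).
  by rewrite -[X in measurable X]setTI; exact: mX.
transitivity (\int[P]_(w in X n.+1 @^-1` B) (f w)%:E) => //.
rewrite integral_mkcond; apply: eq_integral => w _; rewrite patchE indicE.
have -> : (w \in X n.+1 @^-1` B) = (X n.+1 w \in B) by apply/idP/idP; rewrite !inE.
by case: ifP => _; rewrite ?mul1r ?mul0r.
Qed.

(** The mean of u_0(X_0) ... u_(n-1)(X_(n-1)) v(X_n) for the chain started from
    [y], integrated one step at a time. *)
Fixpoint weighted_law n (u : nat -> borel E -> R) (v : borel E -> \bar R)
    (y : borel E) : \bar R :=
  if n is m.+1 then (u 0%N y)%:E * \int[K y]_y' weighted_law m (u \o S) v y'
  else v y.

(** The recursion peels off the first state, but the Markov property is stated at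
    the last one. *)
Lemma weighted_law_rcons n u v y : weighted_law n.+1 u v y =
  weighted_law n u (fun y' => (u n y')%:E * \int[K y']_y'' v y'') y.
Proof.
elim: n u y => // n ih u y.
rewrite [LHS]/= [RHS]/=; congr (_ * _); apply: eq_integral => y' _.
exact: ih.
Qed.

Lemma markov_chain_weighted n (u : nat -> borel E -> R) (v : borel E -> \bar R) :
  (forall k y, (0 <= u k y)%R) -> (forall k, measurable_fun setT (u k)) ->
  (forall y, 0 <= v y) -> measurable_fun setT v ->
  \int[P]_w ((\prod_(k < n) u k (X k w))%:E * v (X n w)) = weighted_law n u v x.
Proof.
move=> u0 mu; elim: n v => [|n ih] v v0 mv.
  have [X0 _] := chain.
  transitivity (\int[P]_(w in setT) (cst (v x) w)).
    apply: ge0_ae_eq_integral => //.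
    - apply: emeasurable_funM => //.
        rewrite (_ : (fun _ => _) = cst 1)//; apply/funext => w; by rewrite big_ord0.
      by apply: measurableT_comp => //; exact: measurable_funP.
    - by move=> w _; rewrite mule_ge0// big_ord0.
    - by move=> w _; exact: v0.
    - by apply: filterS X0 => w /= -> _; rewrite big_ord0 mul1e.
  rewrite integral_cst//; transitivity (v x * 1); last by rewrite mule1.
  by congr (_ * _); exact: probability_setT.
rewrite weighted_law_rcons -ih; last 2 first.
- by move=> y; rewrite mule_ge0 ?lee_fin// integral_ge0.
- apply: emeasurable_funM; first exact/measurable_EFinP.
  apply: measurable_fun_integral_kernel => // A mA; exact: measurable_kernel.
rewrite (@markov_weight n (fun w => (\prod_(k < n.+1) u k (X k w))%R))//.
- by apply: eq_integral => w _; rewrite big_ord_recr/= EFinM muleA.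
- by move=> w; apply: prodr_ge0.
- apply: measurable_prod => k _.
  exact: (measurableT_comp (mu k) (measurable_state (leq_ord k))).
Qed.

End markov_chain_law.

(** * The law of the embedded chain with its holding times *)

Section jump_process_law.
Context (R : realType) (dO : measure_display) (Omega : measurableType dO)
  (E : ptopologicalType).
Variables (pi : probability (borel E) R)
  (gamma : R.-pker (borel E) ~> (borel E))
  (t : borel E * borel E -> R) (g : R -> R).
Hypothesis ht : density_ratio pi gamma t.
Hypothesis hg : balancing_function g.
Notation rate := (jump_rate gamma t g).
Notation K := (jump_kernel ht hg).

Lemma fine_rate_ge0 y : (0 <= fine (rate y))%R.
Proof. by rewrite fine_ge0// (jump_rate_ge0 ht hg). Qed.

Lemma measurable_fine_rate : measurable_fun setT (fun y => fine (rate y)).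
Proof. by apply: measurableT_comp => //; exact: (measurable_jump_rate ht hg). Qed.

Definition holding_kernel := exp_kernel fine_rate_ge0 measurable_fine_rate.
HB.instance Definition _ := ProbabilityKernel.on holding_kernel.
Notation e := holding_kernel.

Variable G : set (borel E).
Hypothesis mG : measurable G.
Hypothesis rateG : forall y, G y -> 0 < rate y < +oo.
Hypothesis KG : forall y, G y -> K y (~` G) = 0.

Variables (P : probability Omega R) (X : nat -> {mfun Omega >-> borel E})
  (tau : nat -> {mfun Omega >-> \bar R}) (x : borel E).
Hypothesis Gx : G x.
Hypothesis hP : lbmjp gamma t g P X tau x.

Let rateE y : G y -> rate y = (fine (rate y))%:E /\ (0 < fine (rate y))%R.
Proof.
move=> /rateG /andP[r0 roo]; split; last by rewrite fine_gt0// r0.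
by rewrite fineK// ge0_fin_numE// ltW.
Qed.

Let chainK : markov_chain P X (fun y A => K y A) x.
Proof.
have -> : (fun y A => K y A) = embedded_kernel gamma t g.
  by apply/funext => y; apply/funext => A; exact: jump_kernelE.
by case: hP.
Qed.

Let sigmaT I : sigma_of X I setT.
Proof. exact: (@measurableT _ (g_sigma_algebraType _)). Qed.

Lemma state_in_G : {ae P, forall w, forall n, G (X n w)}.
Proof.
have [X0 chainS] := chainK.
have mCG : measurable (~` G) by exact: measurableC.
apply: ae_foralln; elim=> [|n ih]; first by apply: filterS X0 => w ->.
exists (X n.+1 @^-1` (~` G)); split => //.
  by rewrite -[X in measurable X]setTI; exact: measurable_funP.
transitivity (P (setT `&` X n.+1 @^-1` (~` G))); first by rewrite setTI.
rewrite chainS//.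
transitivity (\int[P]_(w in setT) (cst 0 w : \bar R)); last exact: integral0.
apply: ge0_ae_eq_integral => //.
  exact: (measurableT_comp (measurable_kernel K _ mCG) (measurable_funP (X n))).
by apply: filterS ih => w Gw _; rewrite KG.
Qed.

Let measurable_exp_law (B : set (\bar R)) : measurable B ->
  measurable_fun setT (fun y => exp_law (rate y) B).
Proof.
move=> mB; have mr := measurable_jump_rate ht hg.
rewrite (_ : (fun y => _) = fun y => if rate y == +oo then \d_(0 : \bar R) B else
    if rate y == 0 then \d_(+oo : \bar R) B else e y (EFin @^-1` B)); last first.
  apply/funext => y; have := jump_rate_ge0 ht hg y.
  rewrite /holding_kernel; case rE : (rate y) => [r||]//= _; rewrite eqe.
  case: ifPn => // r0; rewrite exp_kernelE ?rE//.
have mE : measurable (EFin @^-1` B : set (measurableTypeR R)).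
  by rewrite -[X in measurable X]setTI; exact: EFin_measurable.
apply: measurable_fun_ifT => //=; first exact: measurable_fun_eqe.
apply: measurable_fun_ifT => //=; first exact: measurable_fun_eqe.
exact: measurable_kernel.
Qed.

Let exp_law_holding y (B : set (\bar R)) : G y ->
  exp_law (rate y) B = e y (EFin @^-1` B).
Proof.
move=> Gy; have [-> r0] := rateE Gy.
rewrite /exp_law gt_eqF// /holding_kernel exp_kernelE//=.
by rewrite gt_eqF.
Qed.

Let measurable_prod_exp_law n (B : nat -> set (\bar R)) :
  (forall k, measurable (B k)) ->
  measurable_fun setT (fun w => \prod_(k < n) exp_law (rate (X k w)) (B k)).
Proof.
move=> mB; elim: n => [|n ih].
  rewrite (_ : (fun w => _) = cst 1)//.
  by apply/funext => w; rewrite big_ord0.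
under eq_fun do rewrite big_ord_recr /=.
apply: emeasurable_funM => //.
exact: (measurableT_comp (measurable_exp_law (mB n)) (measurable_funP (X n))).
Qed.

Let exp_law_ge0 y B : 0 <= exp_law (rate y) B.
Proof.
have := jump_rate_ge0 ht hg y; case: (rate y) => [r||]//=.
rewrite lee_fin => r0; case: ifP => // _.
by apply: integral_ge0 => s _; rewrite lee_fin exponential_pdf_ge0.
Qed.

Let prod_exp_law_ge0 n (B : nat -> set (\bar R)) w :
  0 <= \prod_(k < n) exp_law (rate (X k w)) (B k).
Proof. by elim/big_ind : _ => // y z y0 z0; rewrite mule_ge0. Qed.

Lemma holding_time_fin_num :
  {ae P, forall w, forall n, tau n.+1 w \is a fin_num}.
Proof.
apply: ae_foralln => n; pose I : set (\bar R) := [set +oo; -oo].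
have mI : measurable I by apply: measurableU; exact: emeasurable_set1.
pose B k := if k == n then I else setT.
have mB k : measurable (B k) by rewrite /B; case: ifP.
have [_ hold] := hP; have := hold n.+1 setT B (@sigmaT setT) mB.
rewrite setTI.
have -> : \int[P]_(w in setT) \prod_(k < n.+1) exp_law (rate (X k w)) (B k) = 0.
  transitivity (\int[P]_(w in setT) (cst 0 w : \bar R)); last exact: integral0.
  apply: ge0_ae_eq_integral => //; first exact: measurable_prod_exp_law.
  apply: filterS state_in_G => w Gw _.
  rewrite big_ord_recr /= /B eqxx exp_law_holding//.
  rewrite (_ : _ @^-1` _ = set0) ?measure0 ?mule0//.
  by apply/seteqP; split => s //= [].
move=> PB; exists (\bigcap_(k < n.+1) (tau k.+1 @^-1` B k)); split; [|exact: PB|].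
  apply: bigcap_measurableType => k _; rewrite -[X in measurable X]setTI.
  exact: measurable_funP.
move=> w /= ntau k /= _; rewrite /B; case: eqP => // ->.
by move: ntau; case: (tau n.+1 w) => [r []|_|_]; [by []|by left|by right].
Qed.

(** Holding times are almost surely finite; [fine] makes them real numbers. *)
Definition trajectory (w : Omega) : path_space (borel E) (measurableTypeR R) :=
  fun k => (X k w, fine (tau k.+1 w)).

Lemma measurable_trajectory : measurable_fun setT trajectory.
Proof.
apply: measurable_to_path => k; apply: measurable_fun_pair.
  exact: measurable_funP.
apply: (measurableT_comp (f := fine)); last exact: measurable_funP.
exact: fine_measurable.
Qed.

Lemma weighted_law_cylinder n (U : nat -> set (borel E))
    (V : nat -> set (measurableTypeR R)) y : (forall k, measurable (V k)) ->
  weighted_law K n (fun k y => \1_(U k) y * fine (e y (V k)))%R (cst 1) y =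
  cylinder_law K e n U V y.
Proof.
elim: n U V y => // n ih U V y mV /=.
rewrite EFinM fineK ?pker_fin_num//; congr (_ * _).
by apply: eq_integral => y' _; rewrite -ih// => k; exact: mV.
Qed.

(** Given the chain, the holding times contribute the product of the exponential
    laws, each a function of one state: what remains is a mean of the form
    [markov_chain_weighted] with weights \1_(U k) e(., V k). *)
Lemma trajectory_law n (U : nat -> set (borel E))
    (V : nat -> set (measurableTypeR R)) :
  (forall k, measurable (U k)) -> (forall k, measurable (V k)) ->
  P (trajectory @^-1` cylinder n U V) = cylinder_law K e n U V x.
Proof.
move=> mU mV; rewrite -weighted_law_cylinder//.
pose u k y := (\1_(U k) y * fine (e y (V k)))%R.
have u0 k y : (0 <= u k y)%R by rewrite mulr_ge0// fine_ge0.
have mu k : measurable_fun setT (u k).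
  apply: measurable_funM; first exact: measurable_indic.
  by apply: measurableT_comp => //; exact: measurable_kernel.
rewrite -(markov_chain_weighted chainK n u0 mu)//.
pose B k : set (\bar R) := fine @^-1` V k.
have mB k : measurable (B k).
  by rewrite -[X in measurable X]setTI; exact: (fine_measurable measurableT measurableT (mV k)).
pose C : set Omega := \bigcap_(k < n) (X k @^-1` U k).
have sC : sigma_of X setT C.
  pose H := g_sigma_algebraType
    (\bigcup_(i in setT) preimage_set_system setT (X i) measurable).
  have : measurable (C : set H).
    apply: bigcap_measurableType => k _; apply: sub_sigma_algebra.
    by exists k => //; exists (U k) => //; rewrite setTI.
  by [].
have -> : trajectory @^-1` cylinder n U V =
    C `&` \bigcap_(k < n) (tau k.+1 @^-1` B k).
  apply/seteqP; split => w.
    by move=> h; split => k kn; have [] := h k kn.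
  by move=> [h1 h2] k kn; split; [exact: h1|exact: h2].
have [_ ->//] := hP; rewrite integral_mkcond.
have mC : measurable C.
  apply: bigcap_measurableType => k _; rewrite -[X in measurable X]setTI.
  exact: measurable_funP.
apply: ge0_ae_eq_integral => //.
- apply/(measurable_restrictT _ mC).
  by apply: measurable_funTS; exact: measurable_prod_exp_law.
- apply: emeasurable_funM => //; apply/measurable_EFinP.
  apply: measurable_prod => k _.
  exact: (measurableT_comp (mu k) (measurable_funP (X k))).
- by move=> w _; rewrite patchE; case: ifP.
- by move=> w _; rewrite mule_ge0// lee_fin prodr_ge0.
apply: filterS state_in_G => w Gw _; rewrite mule1 patchE.
have [|nC] := boolP (w \in C).
  rewrite inE => Cw; rewrite (big_morph EFin EFinM erefl).
  apply: eq_bigr => k _; rewrite /u indicE mem_set; last exact: (Cw k (ltn_ord k)).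
  rewrite mul1r fineK ?pker_fin_num// exp_law_holding//.
have [k [kn nUk]] : exists k, (k < n)%N /\ ~ U k (X k w).
  move: nC; rewrite notin_setE => /existsNP[k /not_implyP[kn nU]].
  by exists k.
rewrite (bigD1 (Ordinal kn))//= /u indicE memNset// !mul0r.
exact: erefl.
Qed.

End jump_process_law.

Section path_kernel.
Context (R : realType) d d' (E : measurableType d) (F : measurableType d').
Variables (K : R.-pker E ~> E) (e : R.-pker E ~> F) (G : set E).
Hypothesis mG : measurable G.
Context (dO : measure_display) (Omega : measurableType dO).
Variables (P : E -> probability Omega R) (W : Omega -> path_space E F).
Hypothesis mW : measurable_fun setT W.
Hypothesis law : forall x, G x -> forall n U V, (forall k, measurable (U k)) ->
  (forall k, measurable (V k)) ->
  P x (W @^-1` cylinder n U V) = cylinder_law K e n U V x.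

(** The laws of the trajectories as a kernel. Nothing makes [P] measurable in
    the starting state, but on [G] the law is determined by [K] and [e]; off
    [G], an arbitrary fixed law is taken. *)
Definition path_kernel of measurable G &
    (forall x, G x -> forall n U V, (forall k, measurable (U k)) ->
       (forall k, measurable (V k)) ->
       P x (W @^-1` cylinder n U V) = cylinder_law K e n U V x) :=
  fun x : E => if x \in G
  then (mixture (P x) (kdirac mW) : {measure set (path_space E F) -> \bar R})
  else (\d_(point : path_space E F) : {measure set (path_space E F) -> \bar R}).
Notation p := (path_kernel mG law).

Lemma path_kernelE x A : measurable A -> G x -> p x A = P x (W @^-1` A).
Proof.
move=> mA Gx; rewrite /path_kernel mem_set//= /mixture/=.
transitivity (P x (W @^-1` A `&` setT)); last by rewrite setIT.
rewrite -integral_indic//.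
by rewrite -[X in measurable X]setTI; exact: mW.
Qed.

Let pT x : p x setT = 1.
Proof.
have [Gx|nGx] := pselect (G x).
  by rewrite path_kernelE// preimage_setT; exact: probability_setT.
by rewrite /path_kernel memNset//= diracT.
Qed.

Let pfin x A : measurable A -> p x A < +oo.
Proof.
move=> mA; apply: (@le_lt_trans _ _ 1); last exact: ltry.
by rewrite -(pT x) le_measure ?inE.
Qed.

(** On cylinders the kernel is [cylinder_law], which is measurable in the
    starting state; measurability extends to all events by Dynkin's lemma. *)
Let measurable_path_kernel A : measurable A ->
  measurable_fun setT (fun x => p x A).
Proof.
pose H := [set A | measurable A /\ measurable_fun setT (fun x => p x A)].
suff : <<s @cylinders _ _ E F >> `<=` H by move=> + mA => /(_ _ mA) [].
apply: lambda_system_subset => //; first exact: setI_cylinders.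
- split => //.
  + split => //; rewrite (_ : (fun x => _) = cst 1)//.
    by apply/funext => x; rewrite pT.
  + move=> A1 A2 A21 [mA1 h1] [mA2 h2]; split; first exact: measurableD.
    rewrite (_ : (fun x => _) = (fun x => p x A1 - p x A2)).
      exact: emeasurable_funB.
    by apply/funext => x; rewrite measureD// ?setIidr//; exact: pfin.
  + move=> A_ ndA HA; have mA (n : nat) : measurable (A_ n : set (path_space E F)) by have [] := HA n.
    split; first exact: bigcupT_measurable.
    apply: (emeasurable_fun_cvg (fun n x => p x (A_ n : set (path_space E F)))).
      by move=> n; have [] := HA n.
    move=> x _; apply: nondecreasing_cvg_mu => //.
    exact: bigcupT_measurable.
- move=> _ [n [U [V [mU mV ->]]]]; split; first exact: measurable_cylinder.
  rewrite (_ : (fun x => _) = fun x => if x \in G then cylinder_law K e n U V x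
      else \d_(point : path_space E F) (cylinder n U V)).
    apply: measurable_fun_ifT => //.
    - by apply: (measurable_fun_bool true); rewrite setTI preimage_mem_true.
    - exact: measurable_cylinder_law.
  apply/funext => x; have [Gx|nGx] := pselect (G x).
    by rewrite path_kernelE ?mem_set ?law//; exact: measurable_cylinder.
  by rewrite /path_kernel memNset.
Qed.

HB.instance Definition _ := isKernel.Build _ _ _ _ R p measurable_path_kernel.
HB.instance Definition _ := Kernel_isProbability.Build _ _ _ _ R p pT.

End path_kernel.

(** * Time averages along a piecewise constant path *)

Section time_average.
Context (R : realType) (dO : measure_display) (Omega : measurableType dO)
  (E : ptopologicalType).
Variables (X : nat -> {mfun Omega >-> borel E}) (tau : nat -> {mfun Omega >-> \bar R}).
Variables (w : Omega) (s : nat -> R).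
Hypothesis tauE : forall k, tau k.+1 w = (s k)%:E.
Hypothesis s0 : forall k, (0 <= s k)%R.
Local Notation leb := (@lebesgue_measure R).
Notation Y := (fun u : R => jump_process X tau u w).

Let T n : R := \sum_(0 <= k < n) s k.

Let TS n : T n.+1 = (T n + s n)%R. Proof. by rewrite /T big_nat_recr. Qed.

Let T0 : T 0%N = 0%R. Proof. by rewrite /T big_geq. Qed.

Let T_nd n m : (n <= m)%N -> (T n <= T m)%R.
Proof.
by apply: (homo_leq (r := fun x y => (x <= y)%R)) => [//|x y z|k];
  [exact: le_trans|rewrite TS lerDl].
Qed.

Lemma jump_timeE n : jump_time tau n w = (\sum_(0 <= k < n) s k)%:E.
Proof.
rewrite /jump_time -sumEFin big_add1 /=.
by apply: eq_bigr => k _; rewrite tauE.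
Qed.

Lemma jump_process_on n u : (T n <= u)%R -> (u < T n.+1)%R -> Y u = Some (X n w).
Proof.
move=> Tnu uTn; rewrite /jump_process ifT; last first.
  apply: (lt_le_trans (y := (T n.+1)%:E)); first by rewrite lte_fin.
  by apply: ereal_sup_ubound; exists n.+1 => //; exact: jump_timeE.
congr (Some (X _ w)).
have setE : [set m | jump_time tau m w <= u%:E] = [set m | (m <= n)%N].
  apply/seteqP; split => m /=; rewrite jump_timeE lee_fin -/(T m).
    by move=> Tmu; rewrite leqNgt; apply/negP => /T_nd nm; move: (le_lt_trans Tmu uTn); rewrite ltNge nm.
  by move=> mn; rewrite (le_trans (T_nd mn)).
rewrite setE; have nS : supremums [set m | (m <= n)%N] n.
  by split => [m //|m]; apply => /=.
rewrite /supremum ifF; last by apply/negbTE/set0P; exists n => /=.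
case: xgetP => [y _ yS|/(_ n)//].
exact: (is_subset1_supremums yS nS).
Qed.

Variable beta : R.
Hypothesis beta0 : (0 < beta)%R.
Hypothesis cvgT : (T n / n%:R @[n --> \oo] --> beta)%R.

Let T_gt0 : \forall n \near \oo, (0 < T n)%R.
Proof.
have b2 : (0 < beta / 2)%R by rewrite divr_gt0.
near=> n; have n0 : (0 < n%:R :> R)%R by rewrite ltr0n; near: n; exact: nbhs_infty_gt.
have : (0 < T n / n%:R)%R.
  near: n; apply: (cvgr_gt beta) => //; exact: cvgT.
by rewrite pmulr_lgt0// invr_gt0.
Unshelve. all: by end_near. Qed.

Let T_unbounded u : exists n, (u < T n)%R.
Proof.
have b2 : (0 < beta / 2)%R by rewrite divr_gt0.
have [N uN] := archi_mull (u + 1) b2.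
near \oo => n.
have n0 : (0 < n%:R :> R)%R by rewrite ltr0n; near: n; exact: nbhs_infty_gt.
have : (beta / 2 < T n / n%:R)%R.
  near: n; apply: (cvgr_gt beta) => //.
  by rewrite ltr_pdivrMr// mulr_natr mulr2n ltrDl.
rewrite ltr_pdivlMr// => bT; exists n.
have Nn : (N <= n)%N by near: n; exact: nbhs_infty_ge.
have := uN n Nn; lra.
Unshelve. all: by end_near. Qed.

Let find_index u : (0 <= u)%R -> exists n, (T n <= u)%R /\ (u < T n.+1)%R.
Proof.
move=> u0; case: (ex_minnP (T_unbounded u)) => -[|n] uTn min_n.
  by move: uTn; rewrite T0 ltNge u0.
exists n; split => //; rewrite leNgt; apply/negP => /min_n.
by rewrite ltnn.
Qed.

Lemma jump_times_diverge : \sum_(1 <= k <oo) tau k w = +oo.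
Proof.
apply/cvg_lim => //; rewrite -(cvg_shiftS (fun n => \sum_(1 <= k < n) tau k w)).
apply/cvgeyPge => B; have [N BN] := T_unbounded B.
exists N => // n /= Nn; rewrite -[leRHS]/(jump_time tau n w) jump_timeE lee_fin.
by rewrite (le_trans (ltW BN))// T_nd.
Qed.

Lemma jump_process_alive u : (0 <= u)%R -> exists n, Y u = Some (X n w).
Proof.
by move=> /find_index[n [Tu uT]]; exists n; exact: jump_process_on.
Qed.

Variable h : borel E -> R.
Hypothesis h0 : forall y, (0 <= h y)%R.
Let hY u := (oapp h 0%R (Y u))%:E.

Let hY_ge0 u : 0 <= hY u.
Proof. by rewrite /hY lee_fin; case: (Y u) => //=. Qed.

Let A n : R := \sum_(0 <= k < n) h (X k w) * s k.

(** The process is constant between two jump times, so the integral up to the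
    [n]th jump is a finite sum. *)
Let integral_step n : measurable_fun (`[0%R, T n[ : set R) hY /\
  \int[leb]_(u in `[0%R, T n[) hY u = (A n)%:E.
Proof.
elim: n => [|n [mh ih]].
  rewrite T0 set_itvco0; split; first exact: measurable_fun_set0.
  by rewrite integral_set0 /A big_geq.
have itvE : `[0%R, T n.+1[%classic =
    (`[0%R, T n[ `|` `[T n, T n.+1[)%classic :> set R.
  rewrite -itv_bndbnd_setU// bnd_simp//; [by rewrite -T0 T_nd|exact: T_nd].
have cst_on : {in (`[T n, T n.+1[%classic : set R), hY =1 cst (h (X n w))%:E}.
  move=> u; rewrite inE /= in_itv/= => /andP[Tu uT].
  by rewrite /hY (jump_process_on Tu uT).
have mn : measurable_fun (`[T n, T n.+1[ : set R) hY.
  apply: (eq_measurable_fun (cst (h (X n w))%:E)) => [u uI|].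
    by rewrite cst_on.
  exact: measurable_cst.
have mU : measurable_fun (`[0%R, T n.+1[ : set R) hY.
  by rewrite itvE; apply/measurable_funU.
split => //; rewrite itvE ge0_integral_setU//=; last 2 first.
- by rewrite -itvE.
- apply/disj_setPRL => u /=; rewrite !in_itv/= => /andP[Tu _].
  by rewrite ltNge Tu andbF.
rewrite ih /A big_nat_recr//= EFinD; congr (_ + _).
transitivity (\int[leb]_(u in `[T n, T n.+1[) (cst (h (X n w))%:E u)).
  by apply: eq_integral => u uI; rewrite cst_on.
rewrite integral_cst//= lebesgue_measure_itv/=.
case: ifPn => [_|]; rewrite ?lte_fin.
  by rewrite -EFinB TS addrC addKr.
rewrite -leNgt TS gerDl => sn; have -> : s n = 0%R by apply/eqP; rewrite eq_le sn s0.
by rewrite mulr0 mule0.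
Qed.

Let integral_bounds n u : (T n <= u)%R -> (u < T n.+1)%R ->
  (A n)%:E <= \int[leb]_(v in `[0%R, u]) hY v <= (A n.+1)%:E.
Proof.
move=> Tnu uTn; have [m1 <-] := integral_step n; have [m2 <-] := integral_step n.+1.
have sub1 : `[0%R, u]%classic `<=` (`[0%R, T n.+1[%classic : set R).
  by move=> v /=; rewrite !in_itv/= => /andP[-> /le_lt_trans]; exact.
have sub2 : `[0%R, T n[%classic `<=` (`[0%R, u]%classic : set R).
  by move=> v /=; rewrite !in_itv/= => /andP[-> /ltW/le_trans]; exact.
apply/andP; split; apply: ge0_subset_integral => //.
by apply: measurable_funS m2.
Qed.

Variable alpha : R.
Hypothesis cvgA : (A n / n%:R @[n --> \oo] --> alpha)%R.

Let ratio_shift : (1 - n.+1%:R^-1 : R)%R @[n --> \oo] --> (1 : R)%R.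
Proof.
rewrite -[X in _ --> X]subr0; apply: cvgB; first exact: cvg_cst.
exact: cvg_harmonic.
Qed.

Let lower_cvg : (A n / T n.+1 @[n --> \oo] --> alpha / beta)%R.
Proof.
have bn0 : beta != 0%R by rewrite gt_eqF.
have : ((A n / n%:R) / (T n.+1 / n.+1%:R) * (1 - n.+1%:R^-1) @[n --> \oo]
    --> alpha / beta * 1)%R.
  apply: cvgM => //; apply: cvgM => //; apply: cvgV => //.
  by have := cvgT; rewrite -cvg_shiftS.
rewrite mulr1; apply: cvg_trans; apply: near_eq_cvg; near=> n.
have n0 : (n%:R : R)%R != 0%R.
  by rewrite pnatr_eq0 -lt0n; near: n; exact: nbhs_infty_gt.
have Tn0 : T n.+1 != 0%R.
  rewrite gt_eqF// (lt_le_trans _ (T_nd (leqnSn n)))//; near: n; exact: T_gt0.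
have Sn0 : (n.+1%:R : R)%R != 0%R by rewrite pnatr_eq0.
have -> : (n%:R = n.+1%:R - 1 :> R)%R by rewrite -natr1 addrK.
move: n0; have -> : (n%:R = n.+1%:R - 1 :> R)%R by rewrite -natr1 addrK.
move: (n.+1%:R : R)%R Sn0 => r r0 r1.
by field; rewrite r0 Tn0 r1.
Unshelve. all: by end_near. Qed.

Let upper_cvg : (A n.+1 / T n @[n --> \oo] --> alpha / beta)%R.
Proof.
have bn0 : beta != 0%R by rewrite gt_eqF.
have : ((A n.+1 / n.+1%:R) / (T n / n%:R) / (1 - n.+1%:R^-1) @[n --> \oo]
    --> alpha / beta / 1)%R.
  apply: cvgM; last by apply: cvgV => //; exact: oner_neq0.
  apply: cvgM; last exact: cvgV.
  by have := cvgA; rewrite -cvg_shiftS.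
rewrite divr1; apply: cvg_trans; apply: near_eq_cvg; near=> n.
have n0 : (n%:R : R)%R != 0%R.
  by rewrite pnatr_eq0 -lt0n; near: n; exact: nbhs_infty_gt.
have Tn0 : T n != 0%R by rewrite gt_eqF//; near: n; exact: T_gt0.
have Sn0 : (n.+1%:R : R)%R != 0%R by rewrite pnatr_eq0.
move: n0; have -> : (n%:R = n.+1%:R - 1 :> R)%R by rewrite -natr1 addrK.
move: (n.+1%:R : R)%R Sn0 => r r0 r1.
by field; rewrite r0 Tn0 r1.
Unshelve. all: by end_near. Qed.

Lemma time_integral_fin_num u : (0 <= u)%R ->
  \int[leb]_(v in `[0%R, u]) hY v \is a fin_num.
Proof.
move=> u0; have [n [Tu uT]] := find_index u0.
have /andP[_ Iu] := integral_bounds Tu uT.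
by rewrite ge0_fin_numE ?integral_ge0// (le_lt_trans Iu)// ltry.
Qed.

(** For [u] between the jump times [T n] and [T n.+1], the time average lies
    between [A n / T n.+1] and [A n.+1 / T n], which have the same limit. *)
Lemma cvg_time_average :
  (u^-1)%:E * \int[leb]_(v in `[0%R, u]) hY v @[u --> +oo%R] --> (alpha / beta)%:E.
Proof.
apply/fine_cvgP; split.
  near=> u; rewrite fin_numM//; apply: time_integral_fin_num.
  by near: u; exact: nbhs_pinfty_ge.
apply/cvgrPdist_le => eps eps0.
have [M _ HM] : \forall n \near \oo, [/\ (0 < T n)%R,
    (`|alpha / beta - A n / T n.+1| <= eps)%R &
    (`|alpha / beta - A n.+1 / T n| <= eps)%R].
  near=> n; split; near: n; first exact: T_gt0.
  - by move: eps eps0; apply/cvgrPdist_le; exact: lower_cvg.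
  - by move: eps eps0; apply/cvgrPdist_le; exact: upper_cvg.
near=> u.
have u0 : (0 < u)%R by near: u; exact: nbhs_pinfty_gt.
have TMu : (T M <= u)%R by near: u; apply: nbhs_pinfty_ge; exact: num_real.
have [n [Tu uT]] := find_index (ltW u0).
have Mn : (M <= n)%N.
  rewrite leqNgt; apply/negP => nM.
  by have := le_lt_trans TMu uT; rewrite ltNge T_nd.
have [Tn lo up] := HM n Mn.
have If := time_integral_fin_num (ltW u0).
have /andP[AI IA] := integral_bounds Tu uT.
rewrite /= fineM//=; move: AI IA; rewrite -(fineK If) !lee_fin.
move: (fine _) => I AI IA.
have An0 : (0 <= A n)%R by apply: sumr_ge0 => k _; rewrite mulr_ge0.
have loI : (A n / T n.+1 <= u^-1 * I)%R.
  rewrite mulrC ler_pM// ?invr_ge0 ?lef_pV2 ?posrE//.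
  - by rewrite (le_trans (ltW Tn))// T_nd.
  - exact: ltW.
  - exact: lt_trans uT.
have upI : (u^-1 * I <= A n.+1 / T n)%R.
  rewrite [leRHS]mulrC; apply: ler_pM => //.
  - by rewrite invr_ge0 ltW.
  - exact: le_trans AI.
  - by rewrite lef_pV2 ?posrE.
rewrite /=; move: lo up; rewrite !ler_norml => /andP[lo1 lo2] /andP[up1 up2].
by apply/andP; split; lra.
Unshelve. all: by end_near. Qed.

End time_average.

(** * The invariant law of the embedded chain *)

Section invariant_law.
Context (R : realType) (E : ptopologicalType).
Variables (pi : probability (borel E) R)
  (gamma : R.-pker (borel E) ~> (borel E))
  (t : borel E * borel E -> R) (g : R -> R).
Hypothesis ht : density_ratio pi gamma t.
Hypothesis hg : balancing_function g.
Hypothesis g_mono : forall r s : R, (0 <= r)%R -> (r <= s)%R -> (g r <= g s)%R.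
Notation rate := (jump_rate gamma t g).
Notation K := (jump_kernel ht hg).

Variable G : set (borel E).
Hypothesis mG : measurable G.
Hypothesis piG : pi (~` G) = 0.
Hypothesis rateG : forall y, G y -> 0 < rate y < +oo.

Let mr := measurable_jump_rate ht hg.
Let r0 := jump_rate_ge0 ht hg.

Let rateE y : G y -> (fine (rate y))%:E = rate y /\ (0 < fine (rate y))%R.
Proof.
move=> /rateG /andP[rp roo]; split; last by rewrite fine_gt0// rp.
by rewrite fineK// ge0_fin_numE// ltW.
Qed.

Let pi_null N : measurable N -> pi N = 0 -> pi (N `|` ~` G) = 0.
Proof. by move=> mN piN; rewrite measureU0//; exact: measurableC. Qed.

Definition total_rate : R := fine (\int[pi]_x rate x).

Lemma total_rateE : total_rate%:E = \int[pi]_x rate x.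
Proof.
rewrite fineK// ge0_fin_numE; first exact: (integral_jump_rate_lty ht hg g_mono).
by apply: integral_ge0 => x _.
Qed.

Lemma total_rate_gt0 : (0 < total_rate)%R.
Proof.
rewrite -lte_fin total_rateE lt_neqAle integral_ge0// andbT eq_sym; apply/eqP => I0.
have : ae_eq pi setT rate (cst 0).
  apply/(ae_eq_integral_abs pi measurableT mr).
  by rewrite -[RHS]I0; apply: eq_integral => x _; rewrite gee0_abs.
move=> [N [mN piN rN]].
have GN : G `<=` N.
  move=> y Gy; apply: rN => /= /(_ I) ry.
  by have := rateG Gy; rewrite ry ltxx.
have : pi setT = 0.
  apply: (@subset_measure0 _ _ _ pi _ (N `|` ~` G)) => //.
  - by apply: measurableU => //; exact: measurableC.
  - by move=> y _; have [/GN|] := pselect (G y); [left|right].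
  - exact: pi_null.
by rewrite probability_setT => /eqP; rewrite onee_eq0.
Qed.

Let weight x := (fine (rate x) / total_rate)%R.

Let weight_ge0 x : (0 <= weight x)%R.
Proof.
rewrite divr_ge0//; first by rewrite fine_ge0// r0.
exact: (ltW total_rate_gt0).
Qed.

Let measurable_weight : measurable_fun setT weight.
Proof. by apply: measurable_funM => //; exact: measurableT_comp. Qed.

(** Each visit to [x] lasts 1 / rate x on average, so the embedded chain sees [x]
    more often than the process does, in proportion to the rate. *)
Definition invariant_law : set (borel E) -> \bar R :=
  density pi weight_ge0 measurable_weight.
HB.instance Definition _ := Measure.on invariant_law.
Notation eta := invariant_law.

Let weightE A : measurable A ->
  eta A = (total_rate^-1)%:E * \int[pi]_(x in A) rate x.
Proof.
move=> mA; rewrite /eta /= /density -ge0_integralZl//; last 2 first.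
- exact: measurable_funTS.
- by rewrite lee_fin invr_ge0 ltW// total_rate_gt0.
apply: (eq_integral_full mG piG) => //.
- exact/measurable_EFinP.
- by move=> x; rewrite mule_ge0// lee_fin invr_ge0 ltW// total_rate_gt0.
- exact: measurable_funeM.
by move=> x Gx; rewrite /weight mulrC EFinM (rateE Gx).1.
Qed.

Lemma invariant_lawT : eta setT = 1.
Proof.
rewrite weightE// -total_rateE -EFinM mulVf//.
by rewrite gt_eqF// total_rate_gt0.
Qed.

HB.instance Definition _ := Measure_isProbability.Build _ _ _ invariant_law invariant_lawT.

Lemma integral_invariant_law (f : borel E -> \bar R) : (forall x, 0 <= f x) ->
  measurable_fun setT f -> \int[eta]_x f x = \int[pi]_x ((weight x)%:E * f x).
Proof. by move=> f0 mf; rewrite (integral_density weight_ge0 measurable_weight (nu := pi)). Qed.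

(** The density of [invariant_law] is positive on [G], so that both measures have
    the same null sets. *)
Lemma invariant_law_null A : measurable A -> eta A = 0 -> pi A = 0.
Proof.
move=> mA; rewrite weightE// => /eqP; rewrite mule_eq0 eqe invr_eq0.
rewrite (gt_eqF total_rate_gt0)/= => /eqP I0.
have : ae_eq pi A rate (cst 0).
  apply/(ae_eq_integral_abs pi mA); first exact: measurable_funTS.
  by rewrite -[RHS]I0; apply: eq_integral => x _; rewrite gee0_abs.
move=> [N [mN piN rN]].
apply: (@subset_measure0 _ _ _ pi _ (N `|` ~` G)) => //.
- by apply: measurableU => //; exact: measurableC.
- move=> y Ay; have [Gy|] := pselect (G y); [left|by right].
  by apply: rN => /= /(_ Ay) ry; have := rateG Gy; rewrite ry ltxx.
- exact: pi_null.
Qed.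

Lemma invariant_lawG : eta (~` G) = 0.
Proof.
have mCG := measurableC mG.
by rewrite weightE// null_set_integral ?mule0//; exact: measurable_funTS.
Qed.

(** The mean holding time 1 / rate cancels the density. *)
Lemma integral_invariant_law_per_rate (f : borel E -> \bar R) (h : borel E -> R) :
  (forall x, 0 <= f x) -> measurable_fun setT f ->
  (forall x, (0 <= h x)%R) -> measurable_fun setT h ->
  (forall x, G x -> f x = (h x / fine (rate x))%:E) ->
  \int[eta]_x f x = (total_rate^-1)%:E * \int[pi]_x (h x)%:E.
Proof.
move=> f0 mf h0 mh fh; rewrite integral_invariant_law// -ge0_integralZl//; last 3 first.
- exact/measurable_EFinP.
- by move=> x _; rewrite lee_fin.
- by rewrite lee_fin invr_ge0 ltW// total_rate_gt0.
apply: (eq_integral_full mG piG) => //.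
- by move=> x; rewrite mule_ge0// lee_fin.
- by apply: emeasurable_funM => //; exact/measurable_EFinP.
- by move=> x; rewrite -EFinM lee_fin mulr_ge0// invr_ge0 ltW// total_rate_gt0.
- by apply: measurable_funeM; exact/measurable_EFinP.
move=> x Gx; have [_ rp] := rateE Gx; rewrite fh// -!EFinM; congr EFin.
have rn0 : fine (rate x) != 0%R by rewrite gt_eqF.
have Zn0 : total_rate != 0%R by rewrite gt_eqF// total_rate_gt0.
by rewrite /weight; field; rewrite rn0 Zn0.
Qed.

(** In the measure weighted by the rate, a jump from [x] has intensity
    g(t(x, y)) pi(dx) gamma(x, dy), and detailed balance makes the flow into [A]
    equal to the flow out of it. *)
Lemma invariant_law_jump A : measurable A -> \int[eta]_x K x A = eta A.
Proof.
move=> mA; rewrite integral_invariant_law//; last exact: measurable_kernel.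
rewrite weightE// (integral_jump_rate_restrict ht hg mA).
have mint : measurable_fun setT
    (fun x => \int[gamma x]_(y in A) (g (t (x, y)))%:E).
  pose k (z : borel E * borel E) := (\1_A z.2 * g (t z))%:E.
  rewrite (_ : (fun x => _) = fun x => \int[gamma x]_y k (x, y)).
    apply: measurable_fun_integral_finite_kernel.
      by move=> z; rewrite lee_fin mulr_ge0// (balanced_ge0 ht hg).
    apply/measurable_EFinP; apply: measurable_funM.
      by apply: measurableT_comp.
    exact: measurable_balanced ht hg.
  apply/funext => x; rewrite [LHS]integral_mkcond; apply: eq_integral => y _.
  by rewrite patchE /k /= indicE; case: ifP => _; rewrite ?mul1r ?mul0r.
have int0 x : 0 <= \int[gamma x]_(y in A) (g (t (x, y)))%:E.
  by apply: integral_ge0 => y _; rewrite lee_fin (balanced_ge0 ht hg).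
rewrite -ge0_integralZl//; last first.
  by rewrite lee_fin invr_ge0 ltW// total_rate_gt0.
apply: (eq_integral_full mG piG) => //.
- by move=> x; rewrite mule_ge0// lee_fin.
- apply: emeasurable_funM; [exact/measurable_EFinP|exact: measurable_kernel].
- by move=> x; rewrite mule_ge0// lee_fin invr_ge0 ltW// total_rate_gt0.
- exact: measurable_funeM.
move=> x Gx; have [rE rp] := rateE Gx; have /andP[rx roo] := rateG Gx.
rewrite jump_kernelE /embedded_kernel gt_eqF//= lt_eqF//.
under eq_integral do rewrite EFinM.
rewrite ge0_integralZr//; last 3 first.
- apply: measurable_funTS; apply/measurable_EFinP.
  exact: (measurableT_comp (measurable_balanced ht hg) (pair1_measurable x)).
- by move=> y _; rewrite lee_fin (balanced_ge0 ht hg).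
- by rewrite lee_fin invr_ge0 ltW.
rewrite /weight mulrC EFinM muleAC -!muleA; congr (_ * _).
by rewrite -EFinM mulVf ?mule1// gt_eqF.
Qed.

End invariant_law.

(** * Averages along the locally balanced process *)

Section balanced_process.
Context (R : realType) (E : ptopologicalType) (hE : polish R E)
  (pi : probability (borel E) R) (gamma : R.-pker (borel E) ~> (borel E))
  (t : borel E * borel E -> R) (ht : density_ratio pi gamma t)
  (g : R -> R) (hg : balancing_function g)
  (dO : measure_display) (Omega : measurableType dO)
  (P : E -> probability Omega R) (X : nat -> {mfun Omega >-> borel E})
  (tau : nat -> {mfun Omega >-> \bar R}).
Hypothesis hP : forall x, supp pi x -> lbmjp gamma t g (P x) X tau x.
Hypothesis rate_gt0 : forall x, supp pi x -> 0 < jump_rate gamma t g x.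
Hypothesis g_mono : forall r s : R, (0 <= r)%R -> (r <= s)%R -> (g r <= g s)%R.
Variable phi : {measure set (borel E) -> \bar R}.
Hypothesis phi_gt0 : 0 < phi setT.
Hypothesis phi_irr : forall (x : E) (B : set (borel E)),
  supp pi x -> measurable B -> 0 < phi B -> exists n : nat, 0 < P x (X n @^-1` B).
Hypothesis jump_ac : forall (x : E) (A : set (borel E)),
  supp pi x -> measurable A -> pi A = 0 -> embedded_kernel gamma t g x A = 0.

Notation rate := (jump_rate gamma t g).
Notation G := (supp pi : set (borel E)).
Notation K := (jump_kernel ht hg).
Notation e := (holding_kernel ht hg).

Let mG : measurable G. Proof. exact: measurable_supp. Qed.
Let piG : pi (~` G) = 0. Proof. exact: polish_supp_full hE pi. Qed.

(** At a state of infinite rate the embedded chain would stay put, so absolute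
    continuity would make that state an atom of [pi]; but the mean rate under
    [pi] is finite. *)
Lemma supp_rate_lty x : G x -> rate x < +oo.
Proof.
move=> Gx; rewrite ltey; apply/eqP => roo.
have mx := polish_measurable_set1 hE x.
have pix : pi [set x] = 0.
  have mr := measurable_jump_rate ht hg.
  have : pi.-integrable setT rate.
    apply/integrableP; split => //.
    under eq_integral do rewrite gee0_abs ?(jump_rate_ge0 ht hg)//.
    exact: (integral_jump_rate_lty ht hg g_mono).
  move=> /(integrable_ae measurableT) [N [mN piN rN]].
  apply: (@subset_measure0 _ _ _ pi _ N) => // _ ->.
  by apply: rN => /= /(_ I); rewrite roo.
have := jump_ac Gx mx pix; rewrite /embedded_kernel roo eqxx orbT.
by rewrite diracE mem_set// => /eqP; rewrite onee_eq0.
Qed.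

Let rateG y : G y -> 0 < rate y < +oo.
Proof. by move=> Gy; rewrite rate_gt0// supp_rate_lty. Qed.

Let KG y : G y -> K y (~` G) = 0.
Proof. by move=> Gy; rewrite jump_kernelE jump_ac//; exact: measurableC. Qed.

Let W := trajectory X tau.

Let mW : measurable_fun setT W. Proof. exact: measurable_trajectory. Qed.

Let law y (Gy : G y) := @trajectory_law R dO Omega E pi gamma t g ht hg G mG
  rateG KG (P y) X tau y Gy (hP Gy).

Let p := path_kernel mW mG law.
HB.instance Definition _ := ProbabilityKernel.on p.

Let pE x : G x -> forall n U V, (forall k, measurable (U k)) ->
  (forall k, measurable (V k)) -> p x (cylinder n U V) = cylinder_law K e n U V x.
Proof.
move=> Gx n U V mU mV; rewrite /p path_kernelE//; first exact: law.
exact: measurable_cylinder.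
Qed.

Let eta : probability (borel E) R := invariant_law ht hg g_mono mG piG rateG.

Let eta_inv A : measurable A -> \int[eta]_x K x A = eta A.
Proof. exact: invariant_law_jump. Qed.

Let etaG : eta (~` G) = 0. Proof. exact: invariant_lawG. Qed.

Let K_ac x A : G x -> measurable A -> eta A = 0 -> K x A = 0.
Proof.
by move=> Gx mA /(invariant_law_null mA) piA; rewrite jump_kernelE jump_ac.
Qed.

Let p_irr x B : G x -> measurable B -> 0 < phi B ->
  exists n, 0 < p x [set w | B (w n).1].
Proof.
move=> Gx mB /(phi_irr Gx mB)[n Pn]; exists n.
rewrite /p path_kernelE//.
rewrite -[X in measurable X]setTI.
exact: (measurableT_comp (@measurable_fst _ _ _ _) (measurable_coordinate n)).
Qed.

Let ae_trajectory x (S : path_space (borel E) (measurableTypeR R) -> Prop) :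
  G x -> {ae p x, forall w, S w} -> {ae P x, forall w, S (W w)}.
Proof.
move=> Gx [N [mN pN SN]]; exists (W @^-1` N); split.
- by rewrite -[X in measurable X]setTI; exact: mW.
- by rewrite -pN /p path_kernelE.
- by move=> w nS; exact: SN.
Qed.

Lemma holding_time_ge0 x : G x ->
  {ae P x, forall w, forall k, (0 <= fine (tau k.+1 w))%R}.
Proof.
move=> Gx; apply: ae_foralln => k.
pose N : set (borel E * measurableTypeR R) := [set z | (z.2 < 0)%R].
have mN : measurable N.
  rewrite -[X in measurable X]setTI.
  have := @measurable_fun_ltr _ (borel E * measurableTypeR R)%type R setT snd (cst 0%R)
    (measurable_snd) (measurable_cst _).
  exact.
have eN y : G y -> e y (xsection N y) = 0.
  by move=> Gy; rewrite xsectionE; exact: exp_kernel_neg.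
have pN := law_coordinate_null mG KG pE mN eN k Gx.
apply: (@ae_trajectory x (fun w => (0 <= (w k).2)%R)) => //.
exists [set w | N (w k)]; split => //.
  by rewrite -[X in measurable X]setTI; exact: measurable_coordinate.
by move=> w /= /negP; rewrite -ltNge.
Qed.

Notation Z := (total_rate pi gamma t g).

(** Law of large numbers for the observable [h (X k) * tau k.+1]. Its mean given
    [X k] is h / rate, and the stationary law of the states has density rate / Z
    with respect to [pi]. *)
Lemma holding_time_average (h : borel E -> R) x : G x ->
  (forall y, (0 <= h y)%R) -> measurable_fun setT h ->
  \int[pi]_y (h y)%:E < +oo ->
  {ae P x, forall w, ((\sum_(0 <= k < n) h (X k w) * fine (tau k.+1 w)) / n%:R
     @[n --> \oo] --> fine (\int[pi]_y (h y)%:E) / Z)%R}.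
Proof.
move=> Gx h0 mh hoo.
pose z (q : borel E * measurableTypeR R) : R := (h q.1 * Num.max q.2 0)%R.
have z0 q : (0 <= z q)%R by rewrite mulr_ge0// le_max lexx orbT.
have mz : measurable_fun setT z.
  apply: measurable_funM; first exact: (measurableT_comp mh).
  by apply: measurable_maxr.
have mmax : measurable_fun setT (fun s : measurableTypeR R => (Num.max s 0%R)%:E).
  by apply/measurable_EFinP; exact: measurable_maxr.
have hfin : \int[pi]_y (h y)%:E \is a fin_num.
  by rewrite ge0_fin_numE// integral_ge0// => y _; rewrite lee_fin.
have zm : stationary_mean p eta z = (fine (\int[pi]_y (h y)%:E) / Z)%:E.
  rewrite /stationary_mean.
  rewrite (stationary_integral_first mG KG pE etaG (f := EFin \o z))//; last first.
    exact/measurable_EFinP.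
  rewrite (integral_invariant_law_per_rate ht hg g_mono mG piG rateG _ _ h0 mh); last 3 first.
  - by move=> y; apply: integral_ge0 => s _; rewrite lee_fin.
  - apply: (measurable_fun_integral_finite_kernel (EFin \o z)) => //.
    exact/measurable_EFinP.
  - move=> y Gy; have /andP[rp roo] := rateG Gy.
    rewrite /z /=; under eq_integral do rewrite EFinM.
    rewrite ge0_integralZl ?lee_fin//; last first.
      by move=> s _; rewrite lee_fin le_max lexx orbT.
    by rewrite exp_kernel_mean ?fine_gt0 ?rp// EFinM.
  by rewrite mulrC EFinM fineK.
have := law_of_large_numbers mG KG pE eta_inv etaG K_ac phi_gt0 p_irr mz z0 zm Gx.
move=> /(ae_trajectory Gx); apply: filterS2 (holding_time_ge0 Gx) => w tau0.
rewrite /path_sum /z /=.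
under eq_fun do under eq_bigr do rewrite max_l//.
by [].
Qed.

End balanced_process.

Unset Implicit Arguments.

Theorem theorem2p2 (R : realType) (E : ptopologicalType) (hE : polish R E)
  (pi : probability (borel E) R) (gamma : R.-pker (borel E) ~> (borel E))
  (t : borel E * borel E -> R) (ht : density_ratio pi gamma t)
  (g : R -> R) (hg : balancing_function g)
  (dO : measure_display) (Omega : measurableType dO)
  (P : E -> probability Omega R) (X : nat -> {mfun Omega >-> borel E})
  (tau : nat -> {mfun Omega >-> \bar R})
  (hP : forall x, supp pi x -> lbmjp gamma t g (P x) X tau x)
  (h1 : forall x, supp pi x -> 0 < jump_rate gamma t g x)
  (h2_mono : forall r s : R, (0 <= r)%R -> (r <= s)%R -> (g r <= g s)%R)
  (h2_cont : {within `[0%R, +oo[, continuous g})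
  (h3 : exists phi : {measure set (borel E) -> \bar R},
      0 < phi setT /\
      forall (x : E) (B : set (borel E)),
        supp pi x -> measurable B -> 0 < phi B ->
        exists n : nat, 0 < P x (X n @^-1` B))
  (h4 : forall (x : E) (A : set (borel E)),
      supp pi x -> measurable A -> pi A = 0 ->
      embedded_kernel gamma t g x A = 0)
  (x : E) (hx : supp pi x) :
  [/\ {ae P x, forall w, \sum_(1 <= k <oo) tau k w = +oo},
      {ae P x, forall w, forall s : R, (0 <= s)%R ->
        exists2 y : E, jump_process X tau s w = Some y &
          supp pi y /\ jump_rate gamma t g y < +oo}
    & forall f : borel E -> R, pi.-integrable setT (EFin \o f) ->
      {ae P x, forall w,
        (u^-1)%:E * \int[lebesgue_measure]_(s in `[0%R, u])
            (oapp f 0%R (jump_process X tau s w))%:E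
          @[u --> +oo%R] --> \int[pi]_y (f y)%:E}].
Proof.
have [phi [phi_gt0 phi_irr]] := h3.
have rate_fin := supp_rate_lty hE ht hg h2_mono h4.
have mG := measurable_supp pi.
have piG := polish_supp_full hE pi.
have rateG y : supp pi y -> 0 < jump_rate gamma t g y < +oo.
  by move=> Gy; rewrite h1//= rate_fin.
have KG y : supp pi y -> jump_kernel ht hg y (~` supp pi) = 0.
  by move=> Gy; rewrite jump_kernelE h4//; exact: measurableC.
pose s w k := fine (tau k.+1 w).
pose Z := total_rate pi gamma t g.
have Z0 : (0 < Z)%R by exact: (total_rate_gt0 ht hg h2_mono mG piG rateG).
have average h := @holding_time_average R E hE pi gamma t ht g hg dO Omega P X
  tau hP h1 h2_mono phi phi_gt0 phi_irr h4 h x hx.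
(* The observable 1 gives the growth of the jump times. *)
have good : {ae P x, forall w, [/\ forall n, supp pi (X n w),
    forall k, tau k.+1 w = (s w k)%:E, forall k, (0 <= s w k)%R &
    ((\sum_(0 <= k < n) s w k) / n%:R @[n --> \oo] --> Z^-1)%R]}.
  have aG := state_in_G mG KG hx (hP x hx).
  have afin := holding_time_fin_num mG rateG KG hx (hP x hx).
  have apos := holding_time_ge0 hE ht hg hP h1 h2_mono h4 hx.
  have int1 : \int[pi]_y ((cst 1%R : borel E -> R) y)%:E = 1.
    transitivity (\int[pi]_(y in setT) (cst 1 y : \bar R)) => //.
    by rewrite integral_cst// mul1e; exact: probability_setT.
  have a1 : {ae P x, forall w,
      ((\sum_(0 <= k < n) s w k) / n%:R @[n --> \oo] --> Z^-1)%R}.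
    have := average (cst 1%R) (fun=> ler01) (@measurable_cst _ _ _ _ _ _).
    rewrite int1 => /(_ (ltry _)); apply: filterS => w; rewrite /= div1r.
    by under eq_fun do under eq_bigr do rewrite mul1r.
  move: aG; apply: filterS3 afin (filterI apos a1) => w fin_w [pos_w cvg_w] G_w.
  by split => // k; rewrite /s fineK.
split.
- apply: filterS good => w [_ sE s0 cvg_s].
  by apply: (jump_times_diverge sE s0 _ cvg_s); rewrite invr_gt0.
- apply: filterS good => w [G_w sE s0 cvg_s] u u0.
  have Zi : (0 < Z^-1)%R by rewrite invr_gt0.
  have [n Yu] := jump_process_alive X sE s0 Zi cvg_s u0.
  by exists (X n w) => //; split; [exact: G_w|exact: rate_fin].
move=> f intf.
have mf : measurable_fun setT f.
  by apply/measurable_EFinP; exact: (measurable_int _ intf).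
pose fp y : R := Num.max (f y) 0%R; pose fn y : R := Num.max (- f y)%R 0%R.
have fp0 y : (0 <= fp y)%R by rewrite le_max lexx orbT.
have fn0 y : (0 <= fn y)%R by rewrite le_max lexx orbT.
have mfp : measurable_fun setT fp by exact: measurable_maxr.
have mfn : measurable_fun setT fn.
  by apply: measurable_maxr => //; exact: measurableT_comp.
have fposE : (EFin \o f)^\+ = EFin \o fp.
  by apply/funext => y; rewrite funeposE/= EFin_max.
have fnegE : (EFin \o f)^\- = EFin \o fn.
  by apply/funext => y; rewrite funenegE/= EFin_max.
have fp_oo : \int[pi]_y (fp y)%:E < +oo.
  have := integrable_funepos measurableT intf; rewrite fposE => /integrableP[_].
  by under eq_integral do rewrite gee0_abs ?lee_fin//=.
have fn_oo : \int[pi]_y (fn y)%:E < +oo.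
  have := integrable_funeneg measurableT intf; rewrite fnegE => /integrableP[_].
  by under eq_integral do rewrite gee0_abs ?lee_fin//=.
have Ip : \int[pi]_y (fp y)%:E \is a fin_num.
  by rewrite ge0_fin_numE//; apply: integral_ge0 => y _; rewrite lee_fin.
have In : \int[pi]_y (fn y)%:E \is a fin_num.
  by rewrite ge0_fin_numE//; apply: integral_ge0 => y _; rewrite lee_fin.
have pifE : \int[pi]_y (f y)%:E = \int[pi]_y (fp y)%:E - \int[pi]_y (fn y)%:E.
  by rewrite integralE -[X in X^\+]/(EFin \o f) -[X in X^\-]/(EFin \o f) fposE fnegE.
move: good; apply: filterS3 (average fp fp0 mfp fp_oo) (average fn fn0 mfn fn_oo).
move=> w avp avn [_ sE s0 cvg_s].
have Zi : (0 < Z^-1)%R by rewrite invr_gt0.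
have Zn0 : Z != 0%R by rewrite gt_eqF.
have cvp := cvg_time_average sE s0 Zi cvg_s fp0 avp.
have cvn := cvg_time_average sE s0 Zi cvg_s fn0 avn.
have ZK (r : R) : (r / Z / Z^-1 = r)%R by rewrite invrK divfK.
rewrite !ZK fineK// in cvp; rewrite !ZK fineK// in cvn.
have def : \int[pi]_y (fp y)%:E +? - \int[pi]_y (fn y)%:E.
  exact: fin_num_adde_defr.
(* the two time averages can be subtracted once they are known to be finite *)
rewrite pifE; apply: (cvg_trans _ (cvgeB def cvp cvn)); apply: near_eq_cvg; near=> u.
have u0 : (0 <= u)%R by near: u; exact: nbhs_pinfty_ge.
have finp := time_integral_fin_num X sE s0 Zi cvg_s fp0 u0.
have finn := time_integral_fin_num X sE s0 Zi cvg_s fn0 u0.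
rewrite -muleBr//; last exact: fin_num_adde_defr.
congr (_ * _); rewrite [RHS]integralE; congr (_ - _); apply: eq_integral => v _.
- by rewrite funeposE; case: (jump_process X tau v w) => [y|]/=; rewrite -EFin_max// maxxx.
- rewrite funenegE; case: (jump_process X tau v w) => [y|]/=; first by rewrite -EFin_max.
  by rewrite oppr0 maxxx.
Unshelve. all: by end_near. Qed.
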